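(* Let $V_1,\dots,V_m$ be matrix ordered operator spaces and let $\lambda=(\lambda_n)_{n\in\mathbb N}$ be a sequence of $m$-linear maps (satisfying the standing conditions listed in the context) that satisfies (O1) and (O2). Then the algebraic tensor product $V_1\otimes\cdots\otimes V_m$, equipped with the matrix norms $\{\|\cdot\|_{\lambda,n}\}_{n=1}^\infty$ and the cones $M_n(\otimes_\lambda V_i)^+:=\overline{\mathcal C_n}^{\,\|\cdot\|_{\lambda,n}}$, is a matrix ordered operator space, where $$\mathcal C_n=\{\alpha\otimes_{\lambda_j}(v_1,\dots,v_m)\alpha^*: v_t\in M_j(V_t)^+\ (t=1,\dots,m),\ \alpha\in M_{n,\tau(j)},\ j\in\mathbb N\}.$$
   Context: **Matrices.** $M_{k,l}$ denotes the complex $k\times l$ matrices with operator norm, $M_k=M_{k,k}$, and $M_{k,l}(W)=M_{k,l}\otimes W$ for a vector space $W$. $\varepsilon^{[k]}_{i,j}\in M_k$ is the matrix unit with $1$ in position $(i,j)$, with the convention $\varepsilon^{[k]}_{i,j}=0$ if $(i,j)\notin\{1,\dots,k\}^2$; $\varepsilon^{[k]}_j=\varepsilon^{[k]}_{j,j}$. $I_p$ is the identity of $M_p$. **$\lambda$-theory.** Fix $m\in\mathbb N$. $\lambda=(\lambda_k)_{k\in\mathbb N}$ is a sequence of $m$-linear maps $\lambda_k:M_k\times\cdots\times M_k\to M_{\tau(k)}$ with $\tau(k)\in\mathbb N$; $\|\lambda_k\|$ is its norm as a bounded $m$-linear map. For vector spaces $V_1,\dots,V_m$, $\otimes_{\lambda_k}:M_k(V_1)\times\cdots\times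 M_k(V_m)\to M_{\tau(k)}(V_1\otimes\cdots\otimes V_m)$ is the $m$-linear map with $\otimes_{\lambda_k}(\alpha_1\otimes v_1,\dots,\alpha_m\otimes v_m)=\lambda_k(\alpha_1,\dots,\alpha_m)\otimes v_1\otimes\cdots\otimes v_m$. For operator spaces $V_i$ and $u\in M_k(V_1\otimes\cdots\otimes V_m)$, $$\|u\|_{\lambda,k}=\inf\{\|\alpha\|\|v_1\|\cdots\|v_m\|\|\beta\|\},$$ the infimum over all representations $u=\alpha\otimes_{\lambda_j}(v_1,\dots,v_m)\beta$ with $j\in\mathbb N$, $\alpha\in M_{k,\tau(j)}$, $\beta\in M_{\tau(j),k}$, $v_t\in M_j(V_t)$. **Standing conditions on $\lambda$.** (N1) $\tau(1)=1$. (N2) $\|\lambda_j\|=1$ for all $j$. (E1) For all $k$ there exist $p\in\mathbb N$, $S\in M_{k,\tau(p)}$, $T\in M_{\tau(p),k}$, $a_1,\dots,a_k\in M_p$ such that for all $j_1,\dots,j_m\in\{1,\dots,k\}$, $S\lambda_p(a_{j_1},\dots,a_{j_m})T=\varepsilon_j^{[k]}$ if $j_1=\cdots=j_m=j$, and $=0$ otherwise. (E2) For all $r,s\in\mathbb N$ there is $P\in M_{\tau(r)+\tau(s),\tau(r+s)}$ with $\|P\|\le1$ such that for all $(i_k,j_k)\in\{1,\dots,r\}^2\cup\{r+1,\dots,r+s\}^2$, $1\le k\le m$, $P\lambda_{r+s}(\varepsilon^{[r+s]}_{i_1,j_1},\dots,\varepsilon^{[r+s]}_{i_m,j_m})P^*=\mathrm{diag}\big(\lambda_r(\varepsilon^{[r]}_{i_1,j_1},\dots,\varepsilon^{[r]}_{i_m,j_m}),\lambda_s(\varepsilon^{[s]}_{i_1-r,j_1-r},\dots,\varepsilon^{[s]}_{i_m-r,j_m-r})\big).$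 (E3) $\lambda_1(1,\dots,1)=1$ and $\sup_k\|\lambda_k\|<\infty$. (W1) For each $j\in\{1,\dots,m\}$ and all $\gamma\in M_p$ there are $P\in M_{p,\tau(p)}$, $Q\in M_{\tau(p),p}$ with $\|P\|,\|Q\|\le1$ and $\gamma=P\lambda_p(I_p,\dots,I_p,\gamma,I_p,\dots,I_p)Q$ ($\gamma$ in the $j$-th position). (W2) For all $\alpha_1,\dots,\alpha_m\in M_p$, $\beta_1,\dots,\beta_m\in M_q$ there are $S\in M_{\tau(p)\tau(q),\tau(pq)}$, $T\in M_{\tau(pq),\tau(p)\tau(q)}$ with $\|S\|,\|T\|\le1$ and $\lambda_p(\alpha_1,\dots,\alpha_m)\otimes\lambda_q(\beta_1,\dots,\beta_m)=S\lambda_{pq}(\alpha_1\otimes\beta_1,\dots,\alpha_m\otimes\beta_m)T$. **Further conditions.** (O1) For each $r$ and all $(i_k,j_k)\in\{1,\dots,r\}^2$: $\lambda_r(\varepsilon^{[r]}_{i_1,j_1},\dots,\varepsilon^{[r]}_{i_m,j_m})=\lambda_r(\varepsilon^{[r]}_{j_1,i_1},\dots,\varepsilon^{[r]}_{j_m,i_m})^*$. (O2) For each $r$, the matrix $P\in M_{2\tau(r),\tau(2r)}$, $\|P\|\le1$, of (E2) with $s=r$ also satisfies, for all $(i_k,j_k)\in R\cup S$, where $R=\{1,\dots,r\}\times\{r+1,\dots,2r\}$ and $S=\{r+1,\dots,2r\}\times\{1,\dots,r\}$, $$P\lambda_{2r}(\varepsilon^{[2r]}_{i_1,j_1},\dots,\varepsilon^{[2r]}_{i_m,j_m})P^*=\begin{pmatrix}0&\lambda_r(\varepsilon^{[r]}_{i_1,j_1-r},\dots,\varepsilon^{[r]}_{i_m,j_m-r})\\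 \lambda_r(\varepsilon^{[r]}_{i_1-r,j_1},\dots,\varepsilon^{[r]}_{i_m-r,j_m})&0\end{pmatrix}.$$ **Matrix ordered operator spaces.** An operator space $V$ (norms not assumed complete) is a matrix ordered operator space if $V$ is a complex $*$-vector space with cones $M_n(V)^+\subseteq M_n(V)_{sa}$ such that $A^*M_n(V)^+A\subseteq M_k(V)^+$ for all $A\in M_{n,k}$, the $*$-operation is an isometry on each $M_n(V)$, and each $M_n(V)^+$ is closed (cones are not assumed proper). Here $M_n(V)$ has the involution $[v_{ij}]^*=[v_{ji}^*]$. **Involution on the tensor product.** $M_n(V_1\otimes\cdots\otimes V_m)$ carries the involution $\big(\alpha\otimes_{\lambda_r}(v_1,\dots,v_m)\beta\big)^*=\beta^*\otimes_{\lambda_r}(v_1^*,\dots,v_m^* )\alpha^*$ (well defined under (O1); it is the one induced by $(v_1\otimes\cdots\otimes v_m)^*=v_1^*\otimes\cdots\otimes v_m^*$). *)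

(* Defs.v *)
From HB Require Import structures.
From mathcomp Require Import all_boot all_order all_algebra.
From mathcomp Require Import all_classical all_reals.
From mathcomp Require Import complex mxtens.

Set Implicit Arguments.
Unset Strict Implicit.
Unset Printing Implicit Defensive.

Import Order.TTheory GRing.Theory Num.Theory.

Local Open Scope classical_set_scope.
Local Open Scope ring_scope.
Local Open Scope sesquilinear_scope.
Local Open Scope quotient_scope.

Reserved Notation "a *ml v" (at level 40, left associativity).
Reserved Notation "v *mr b" (at level 40, left associativity).

Section ScalarMatrices.
Variable R : realType.
Local Notation C := R[i].

Definition l2norm n (x : 'cV[C]_n) : R :=
  Num.sqrt (\sum_(i < n) Normc.normc (x i 0) ^+ 2).

Definition opnorm k l (A : 'M[C]_(k, l)) : R :=
  sup [set l2norm (A *m x) | x in [set x | l2norm x <= 1]].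

(* The matrix unit of M_k with 1 in position (i, j), the positions being       *)
(* numbered from 1, and 0 when (i, j) is out of range. A truncated difference  *)
(* i - r with i <= r is 0, hence out of range, like the integer it stands for. *)
Definition eps k (i j : nat) : 'M[C]_k :=
  \matrix_(a, b) ((a.+1 == i) && (b.+1 == j))%:R.

End ScalarMatrices.

Section Multilinear.
Variables (R : realType) (m : nat).
Local Notation C := R[i].

Definition multilinear (U : 'I_m -> lmodType C) (W : lmodType C)
    (f : (forall t, U t) -> W) : Prop :=
  forall (u : forall t, U t) (t : 'I_m), linear (fun x : U t => f (dfwith u t x)).

Definition mlnorm k l (f : ('I_m -> 'M[C]_k) -> 'M[C]_l) : R :=
  sup [set opnorm (f a) | a in [set a | forall t, opnorm (a t) <= 1]].

Section MultilinearTheory.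
Variables (U : 'I_m -> lmodType C) (W : lmodType C) (f : (forall t, U t) -> W).
Hypothesis fM : multilinear f.

Lemma multilinear0 (u : forall t, U t) t : f (dfwith u t 0) = 0.
Proof.
have := @fM u t (-1) 0 0; rewrite !scaleN1r addNr => ->.
by rewrite addNr.
Qed.

Lemma multilinear_sum1 (J : finType) (u : forall t, U t) t
    (c : J -> C) (x : J -> U t) :
  f (dfwith u t (\sum_j c j *: x j)) = \sum_j c j *: f (dfwith u t (x j)).
Proof.
elim/big_rec2: _ => [|j y z _ <-]; first exact: multilinear0.
exact: fM.
Qed.

Let mix (s : seq 'I_m) (a b : forall t, U t) : forall t, U t :=
  fun t => if t \in s then a t else b t.

Let multilinear_sum_seq (J : finType) (j0 : J) (c : 'I_m -> J -> C)
    (u : forall t, J -> U t) (s : seq 'I_m) (w : forall t, U t) : uniq s ->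
  f (mix s (fun t => \sum_j c t j *: u t j) w) =
  \sum_(g in pffun_on j0 (mem s) predT)
     (\prod_(t <- s) c t (g t)) *: f (mix s (fun t => u t (g t)) w).
Proof.
elim: s w => [|a s ih] w /= => [_|/andP[as_ us]].
  rewrite (big_pred1 [ffun=> j0]) => [|g].
    by rewrite big_nil scale1r; congr f.
  apply/pffun_onP/eqP => [[/supportP g0 _]|->].
    by apply/ffunP => t; rewrite ffunE g0.
  by split=> //; apply/supportP => t _; rewrite ffunE.
have mixE z y : mix s z (dfwith w a y) = dfwith (mix s z w) a y.
  apply/functional_extensionality_dep => t; rewrite /mix.
  have [<-|at_] := eqVneq a t; first by rewrite (negbTE as_) !dfwithin.
  by rewrite !dfwithout.
have mix_cons z : mix (a :: s) z w = dfwith (mix s z w) a (z a).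
  apply/functional_extensionality_dep => t; rewrite /mix in_cons.
  have [<-|at_] := eqVneq a t; first by rewrite dfwithin.
  by rewrite dfwithout.
rewrite mix_cons -mixE ih //.
transitivity (\sum_(g in pffun_on j0 (mem s) predT) \sum_(x : J)
    (\prod_(t <- s) c t (g t)) *:
      (c a x *: f (dfwith (mix s (fun t => u t (g t)) w) a (u a x)))).
  by apply: eq_bigr => g _; rewrite -scaler_sumr -multilinear_sum1 -mixE.
rewrite pair_big_dep /=.
pose upd (p : {ffun 'I_m -> J} * J) : {ffun 'I_m -> J} :=
  [ffun t => if t == a then p.2 else p.1 t].
rewrite (reindex_onto upd
  (fun h : {ffun 'I_m -> J} => ([ffun t => if t == a then j0 else h t], h a))) /=.
  apply: eq_big => [[g x]|[g x] /=].
    apply/andP/andP => /=.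
      move=> [/pffun_onP[/supportP g0 _] _]; split.
        apply/pffun_onP; split=> //; apply/supportP => t.
        by rewrite inE negb_or ffunE /= => /andP[/negbTE-> /g0].
      apply/eqP; congr (_, _); last by rewrite ffunE eqxx.
      apply/ffunP => t; rewrite !ffunE; case: eqVneq => // ->.
      by rewrite g0.
    move=> [/pffun_onP[/supportP g0 _] /eqP[gE _]]; split=> //.
    apply/pffun_onP; split=> //; apply/supportP => t ts.
    rewrite -gE !ffunE; case: eqVneq => // ta.
    have := g0 t; rewrite !ffunE (negbTE ta); apply.
    by rewrite inE negb_or ta.
  move=> _; rewrite scalerA big_cons ffunE eqxx mulrC; congr ((_ * _) *: _).
    apply: eq_big_seq => t ts; rewrite ffunE /=; case: eqVneq => // ta.
    by rewrite -ta ts in as_.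
  rewrite mix_cons; set z := upd _ a; have -> : z = x by rewrite /z ffunE eqxx.
  congr f; congr (@dfwith _ (fun t => U t) _ a (u a x)).
  apply/functional_extensionality_dep => t; rewrite /mix; case: ifP => // ts.
  by rewrite ffunE; case: eqVneq => //= ta; rewrite -ta ts in as_.
move=> h _; apply/ffunP => t; rewrite !ffunE /=.
by case: eqVneq => [->|].
Qed.

Lemma multilinear_sum (J : finType) (c : 'I_m -> J -> C)
    (u : forall t, J -> U t) : (0 < #|J|)%N ->
  f (fun t => \sum_j c t j *: u t j) =
  \sum_(g : {ffun 'I_m -> J}) (\prod_t c t (g t)) *: f (fun t => u t (g t)).
Proof.
move=> /card_gt0P[j0 _].
have mixE a b : mix (enum 'I_m) a b = a.
  by apply/functional_extensionality_dep => t; rewrite /mix mem_enum.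
rewrite -[X in f X](mixE _ (fun=> 0)) (multilinear_sum_seq j0) ?enum_uniq //.
apply: eq_big => [g|g _]; last by rewrite mixE big_enum.
apply/pffun_onP; split=> //; apply/supportP => t.
by rewrite mem_enum.
Qed.

Lemma multilinear_scale (c : 'I_m -> C) (u : forall t, U t) :
  f (fun t => c t *: u t) = (\prod_t c t) *: f u.
Proof.
have := @multilinear_sum 'I_1 (fun t _ => c t) (fun t _ => u t).
rewrite card_ord => /(_ isT) h.
transitivity (f (fun t => \sum_(j < 1) c t *: u t)).
  by congr f; apply/functional_extensionality_dep => t; rewrite big_ord1.
rewrite h (big_pred1 [ffun=> ord0]) // => g /=; apply/esym/eqP/ffunP => t.
by rewrite ffunE ord1.
Qed.

End MultilinearTheory.
End Multilinear.

(* The tensor product is the space of formal linear combinations of families   *)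
(* v = (v_t)_t modulo those on which every multilinear map vanishes. By         *)
(* [tpure_multilinear], [tensor_universal] and [tensor_ind] below it has the    *)
(* universal property of the algebraic tensor product.                          *)
Section TensorProduct.
Variables (R : realType) (m : nat).
Local Notation C := R[i].
Variable V : 'I_m -> lmodType C.

Definition tformal : Type := seq (C * (forall t, V t)).

HB.instance Definition _ := Choice.on tformal.

Definition teval (W : lmodType C) (f : (forall t, V t) -> W) (s : tformal) : W :=
  \sum_(x <- s) x.1 *: f x.2.

Definition trel (s1 s2 : tformal) : bool :=
  `[< forall (W : lmodType C) (f : (forall t, V t) -> W),
        multilinear f -> teval f s1 = teval f s2 >].

Lemma trel_refl : reflexive trel. Proof. by move=> s; apply/asboolP. Qed.

Lemma trel_sym : symmetric trel.
Proof. by move=> s1 s2; apply/asboolP/asboolP => h W f fM; rewrite h. Qed.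

Lemma trel_trans : transitive trel.
Proof.
by move=> s2 s1 s3 /asboolP h1 /asboolP h2; apply/asboolP => W f fM; rewrite h1 ?h2.
Qed.

Canonical trel_equiv := EquivRel trel trel_refl trel_sym trel_trans.

Definition tensor : Type := {eq_quot trel}.
HB.instance Definition _ := Choice.on tensor.
HB.instance Definition _ := EqQuotient.on tensor.

Definition tlift (W : lmodType C) (f : (forall t, V t) -> W) (x : tensor) : W :=
  teval f (repr x).

Lemma tlift_pi (W : lmodType C) (f : (forall t, V t) -> W) (s : tformal) :
  multilinear f -> tlift f (\pi_tensor s) = teval f s.
Proof.
move=> fM; have /eqmodP/asboolP h : repr (\pi_tensor s) = s %[mod tensor].
  by rewrite reprK.
exact: h.
Qed.

Lemma tensorP (x y : tensor) :
  (forall (W : lmodType C) (f : (forall t, V t) -> W),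
     multilinear f -> tlift f x = tlift f y) -> x = y.
Proof.
move=> h; rewrite -[x]reprK -[y]reprK; apply/eqmodP/asboolP => W f fM.
exact: h.
Qed.

Definition tzero : tensor := \pi_tensor ([::] : tformal).
Definition tadd (x y : tensor) : tensor := \pi_tensor (repr x ++ repr y : tformal).
Definition tscale (c : C) (x : tensor) : tensor :=
  \pi_tensor ([seq (c * z.1, z.2) | z <- repr x] : tformal).
Definition tpure (v : forall t, V t) : tensor := \pi_tensor ([:: (1, v)] : tformal).

Section Lift.
Variables (W : lmodType C) (f : (forall t, V t) -> W).
Hypothesis fM : multilinear f.

Lemma tlift_zero : tlift f tzero = 0.
Proof. by rewrite tlift_pi // /teval big_nil. Qed.

Lemma tlift_add x y : tlift f (tadd x y) = tlift f x + tlift f y.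
Proof. by rewrite tlift_pi // /teval big_cat. Qed.

Lemma tlift_scale c x : tlift f (tscale c x) = c *: tlift f x.
Proof.
rewrite tlift_pi // /teval big_map scaler_sumr.
by apply: eq_bigr => z _; rewrite scalerA.
Qed.

Lemma tlift_pure v : tlift f (tpure v) = f v.
Proof. by rewrite tlift_pi // /teval big_seq1 scale1r. Qed.
End Lift.

Lemma taddA : associative tadd.
Proof. by move=> x y z; apply: tensorP => W f fM; rewrite !tlift_add // addrA. Qed.
Lemma taddC : commutative tadd.
Proof. by move=> x y; apply: tensorP => W f fM; rewrite !tlift_add // addrC. Qed.
Lemma tadd0 : left_id tzero tadd.
Proof.
by move=> x; apply: tensorP => W f fM; rewrite tlift_add // tlift_zero // add0r.
Qed.
Lemma taddN : left_inverse tzero (tscale (-1)) tadd.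
Proof.
move=> x; apply: tensorP => W f fM.
by rewrite tlift_add // tlift_scale // tlift_zero // scaleN1r addNr.
Qed.

HB.instance Definition _ := GRing.isZmodule.Build tensor taddA taddC tadd0 taddN.

Lemma tscaleA (a b : C) (x : tensor) : tscale a (tscale b x) = tscale (a * b) x.
Proof.
by apply: tensorP => W f fM; rewrite !tlift_scale // scalerA.
Qed.
Lemma tscale1 : left_id 1 tscale.
Proof. by move=> x; apply: tensorP => W f fM; rewrite tlift_scale // scale1r. Qed.
Lemma tscaleDr : right_distributive tscale +%R.
Proof.
move=> c x y; apply: tensorP => W f fM.
by rewrite tlift_scale // !tlift_add // !tlift_scale // scalerDr.
Qed.
Lemma tscaleDl (x : tensor) : {morph tscale^~ x : a b / a + b}.
Proof.
move=> a b; apply: tensorP => W f fM.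
by rewrite tlift_add // !tlift_scale // scalerDl.
Qed.

HB.instance Definition _ :=
  GRing.Zmodule_isLmodule.Build C tensor tscaleA tscale1 tscaleDr tscaleDl.

Lemma tlift_linear (W : lmodType C) (f : (forall t, V t) -> W) :
  multilinear f -> linear (tlift f).
Proof. by move=> fM c x y; rewrite tlift_add // tlift_scale. Qed.

Lemma tpure_multilinear : multilinear (tpure : _ -> tensor).
Proof.
move=> u t c x y; apply: tensorP => W f fM.
by rewrite tlift_linear // !tlift_pure // fM.
Qed.

Lemma tensor_pureE (x : tensor) : exists s : tformal, x = teval tpure s.
Proof.
exists (repr x); apply: tensorP => W f fM.
rewrite [RHS](_ : _ = \sum_(z <- repr x) z.1 *: f z.2) //.
rewrite /teval; elim: (repr x) => [|z s ih].
  by rewrite !big_nil; apply: tlift_zero.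
by rewrite !big_cons tlift_linear // ih tlift_pure.
Qed.

Lemma tensor_ind (P : tensor -> Prop) : P 0 ->
  (forall c v x, P x -> P (c *: tpure v + x)) -> forall x, P x.
Proof.
move=> P0 PS x; have [s ->] := tensor_pureE x; rewrite /teval.
by elim: s => [|z s ih]; rewrite ?big_nil // big_cons; apply: PS.
Qed.

Lemma tensor_universal (W : lmodType C) (f : (forall t, V t) -> W) :
  multilinear f ->
  exists! g : tensor -> W, linear g /\ forall v, g (tpure v) = f v.
Proof.
move=> fM; exists (tlift f); split.
  by split=> [|v]; [exact: tlift_linear|exact: tlift_pure].
move=> g [gL gE]; apply/funext; apply: tensor_ind => [|c v x ih].
  have g0 : g 0 = 0.
    by have := gL (-1) 0 0; rewrite !scaleN1r addNr => ->; rewrite addNr.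
  by rewrite g0; apply: tlift_zero.
by rewrite gL gE tlift_linear // tlift_pure // ih.
Qed.

End TensorProduct.


Section TensorInvolution.
Variables (R : realType) (m : nat).
Local Notation C := R[i].

Definition antilinear (V W : lmodType C) (s : V -> W) : Prop :=
  forall (c : C) x y, s (c *: x + y) = c^* *: s x + s y.

Definition conjmod (W : lmodType C) : Type := W.

Section ConjugateModule.
Variable W : lmodType C.

HB.instance Definition _ := GRing.Zmodule.on (conjmod W).

Definition conjscale (c : C) (w : conjmod W) : conjmod W := c^* *: (w : W).

Lemma conjscaleA a b w : conjscale a (conjscale b w) = conjscale (a * b) w.
Proof. by rewrite /conjscale scalerA rmorphM. Qed.
Lemma conjscale1 : left_id 1 conjscale.
Proof. by move=> w; rewrite /conjscale rmorph1 scale1r. Qed.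
Lemma conjscaleDr : right_distributive conjscale +%R.
Proof. by move=> c x y; rewrite /conjscale scalerDr. Qed.
Lemma conjscaleDl w : {morph conjscale^~ w : a b / a + b}.
Proof. by move=> a b; rewrite /conjscale rmorphD scalerDl. Qed.

HB.instance Definition _ := GRing.Zmodule_isLmodule.Build C (conjmod W)
  conjscaleA conjscale1 conjscaleDr conjscaleDl.
End ConjugateModule.

Variables (V : 'I_m -> lmodType C) (s : forall t, V t -> V t).

(* The map sum_i c_i v_i |-> sum_i c_i^* s(v_i), applied to a representative;   *)
(* it does not depend on the representative when every s_t is antilinear, see  *)
(* [tstar_antilinear] and [tstar_pure].                                        *)
Definition tstar (x : tensor V) : tensor V :=
  \pi_(tensor V) ([seq (z.1^*, fun t => s (z.2 t)) | z <- repr x] : tformal V).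

Hypothesis sA : forall t, antilinear (@s t).

Lemma tlift_star (W : lmodType C) (f : (forall t, V t) -> W) (x : tensor V) :
  multilinear f ->
  multilinear (fun v => f (fun t => s (v t)) : conjmod W) /\
  tlift f (tstar x) = tlift (fun v => f (fun t => s (v t)) : conjmod W) x.
Proof.
move=> fM; split; last by rewrite tlift_pi // /teval big_map.
move=> u t c x' y'; have E z : (fun j => s (dfwith u t z j)) =
    dfwith (fun j => s (u j)) t (s z).
  apply/functional_extensionality_dep => j.
  by case: dfwithP => [|j' tj]; rewrite ?dfwithin ?dfwithout.
by rewrite !E sA fM.
Qed.

Lemma tstar_antilinear : antilinear tstar.
Proof.
move=> c x y; apply: tensorP => W f fM; rewrite tlift_linear //.
have [gM ->] := tlift_star (c *: x + y) fM.
rewrite (tlift_star x fM).2 (tlift_star y fM).2.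
exact: (tlift_linear gM).
Qed.

Lemma tstar_pure (v : forall t, V t) : tstar (tpure v) = tpure (fun t => s (v t)).
Proof.
apply: tensorP => W f fM; have [gM ->] := tlift_star (tpure v) fM.
by rewrite !tlift_pure.
Qed.

End TensorInvolution.

Section Amplifications.
Variable R : realType.
Local Notation C := R[i].
Variable V : lmodType C.

Definition lmulV p n q (a : 'M[C]_(p, n)) (v : 'M[V]_(n, q)) : 'M[V]_(p, q) :=
  \matrix_(i, j) \sum_k a i k *: v k j.

Definition rmulV p n q (v : 'M[V]_(p, n)) (b : 'M[C]_(n, q)) : 'M[V]_(p, q) :=
  \matrix_(i, j) \sum_k b k j *: v i k.

Definition scaleV p q (c : C) (v : 'M[V]_(p, q)) : 'M[V]_(p, q) :=
  \matrix_(i, j) (c *: v i j).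

Definition starV (s : V -> V) p q (v : 'M[V]_(p, q)) : 'M[V]_(q, p) :=
  \matrix_(i, j) s (v j i).

Definition elemV p q (a : 'M[C]_(p, q)) (x : V) : 'M[V]_(p, q) :=
  \matrix_(i, j) (a i j *: x).

End Amplifications.

Notation "a *ml v" := (lmulV a v) : ring_scope.
Notation "v *mr b" := (rmulV v b) : ring_scope.

(* Sizes range over the n > 0: the data in size 0 are unconstrained.           *)
Section MatrixOrderedSpaces.
Variable R : realType.
Local Notation C := R[i].

(* Abstract (not necessarily complete) operator spaces, by Ruan's axioms. *)
Record operator_space (V : lmodType C) (N : forall n, 'M[V]_n -> R) : Prop := {
  os_ge0 : forall n (v : 'M[V]_n), (0 < n)%N -> 0 <= N n v;
  os_eq0 : forall n (v : 'M[V]_n), (0 < n)%N -> N n v = 0 -> v = 0;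
  os_scale : forall n (c : C) (v : 'M[V]_n), (0 < n)%N ->
    N n (scaleV c v) = Normc.normc c * N n v;
  os_triangle : forall n (v w : 'M[V]_n), (0 < n)%N -> N n (v + w) <= N n v + N n w;
  os_sum : forall n p (v : 'M[V]_n) (w : 'M[V]_p), (0 < n)%N -> (0 < p)%N ->
    N (n + p)%N (block_mx v 0 0 w) = Num.max (N n v) (N p w);
  os_compress : forall n k (a : 'M[C]_(k, n)) (v : 'M[V]_n) (b : 'M[C]_(n, k)),
    (0 < n)%N -> (0 < k)%N -> N k (a *ml v *mr b) <= opnorm a * N n v * opnorm b
}.

Record mo_structure (V : lmodType C) := MOStructure {
  mnorm : forall n, 'M[V]_n -> R;
  mstar : V -> V;
  mcone : forall n, set 'M[V]_n
}.

Definition norm_closure (T : zmodType) (N : T -> R) (A : set T) : set T :=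
  [set v | forall e, 0 < e -> exists2 w, A w & N (v - w) < e].

Record mo_operator_space (V : lmodType C) (D : mo_structure V) : Prop := {
  mo_os : operator_space (mnorm D);
  mo_starK : involutive (mstar D);
  mo_star_antilinear : antilinear (mstar D);
  mo_cone_sa : forall n (v : 'M[V]_n), (0 < n)%N ->
    mcone D v -> starV (mstar D) v = v;
  mo_cone0 : forall n, (0 < n)%N -> mcone D (0 : 'M[V]_n);
  mo_coneD : forall n (v w : 'M[V]_n), (0 < n)%N ->
    mcone D v -> mcone D w -> mcone D (v + w);
  mo_coneZ : forall n (r : R) (v : 'M[V]_n), (0 < n)%N -> 0 <= r ->
    mcone D v -> mcone D (scaleV (r%:C)%C v);
  mo_cone_compress : forall n k (a : 'M[C]_(n, k)) (v : 'M[V]_n),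
    (0 < n)%N -> (0 < k)%N -> mcone D v -> mcone D (a^t* *ml v *mr a);
  mo_star_isometry : forall n (v : 'M[V]_n), (0 < n)%N ->
    mnorm D (starV (mstar D) v) = mnorm D v;
  mo_cone_closed : forall n, (0 < n)%N ->
    norm_closure (@mnorm V D n) (@mcone V D n) `<=` @mcone V D n
}.

End MatrixOrderedSpaces.

(* The standing conditions on lambda. The map lambda_k is only constrained for  *)
(* k > 0; the indices t = 1, ..., m are the elements of 'I_m.                   *)
Section LambdaConditions.
Variables (R : realType) (m : nat) (tau : nat -> nat).
Local Notation C := R[i].
Variable lam : forall k, ('I_m -> 'M[C]_k) -> 'M[C]_(tau k).

Definition lambda_multilinear : Prop :=
  forall k, (0 < k)%N -> multilinear (U := fun=> 'M[C]_k) (@lam k).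

Definition condN1 : Prop := tau 1%N = 1%N.

Definition condN2 : Prop := forall j, (0 < j)%N -> mlnorm (@lam j) = 1.

Definition condE1 : Prop := forall k, (0 < k)%N ->
  exists p (S : 'M[C]_(k, tau p)) (T : 'M[C]_(tau p, k)) (a : 'I_k -> 'M[C]_p),
    (0 < p)%N /\
    forall j : 'I_m -> 'I_k,
      (forall j0, (forall t, j t = j0) ->
         S *m lam (fun t => a (j t)) *m T = delta_mx j0 j0) /\
      ((~ exists j0, forall t, j t = j0) ->
         S *m lam (fun t => a (j t)) *m T = 0).

Definition condE2_eq r s (P : 'M[C]_(tau r + tau s, tau (r + s))) : Prop :=
  forall i j : 'I_m -> nat,
    (forall t, ((1 <= i t <= r) && (1 <= j t <= r) ||
                (r + 1 <= i t <= r + s) && (r + 1 <= j t <= r + s))%N) ->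
    P *m lam (fun t => eps R (r + s) (i t) (j t)) *m P^t* =
    block_mx (lam (fun t => eps R r (i t) (j t))) 0
             0 (lam (fun t => eps R s (i t - r) (j t - r))).

Definition condE2 : Prop := forall r s, (0 < r)%N -> (0 < s)%N ->
  exists2 P : 'M[C]_(tau r + tau s, tau (r + s)), opnorm P <= 1 & condE2_eq P.

Definition condE3 : Prop :=
  lam (fun=> 1%:M : 'M[C]_1) = 1%:M /\
  has_ubound [set mlnorm (@lam k) | k in [set k | (0 < k)%N]].

Definition condW1 : Prop := forall (j : 'I_m) p (g : 'M[C]_p), (0 < p)%N ->
  exists (P : 'M[C]_(p, tau p)) (Q : 'M[C]_(tau p, p)),
    [/\ opnorm P <= 1, opnorm Q <= 1 &
        g = P *m lam (fun t => if t == j then g else 1%:M) *m Q].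

Definition condW2 : Prop :=
  forall p q (a : 'I_m -> 'M[C]_p) (b : 'I_m -> 'M[C]_q), (0 < p)%N -> (0 < q)%N ->
  exists (S : 'M[C]_(tau p * tau q, tau (p * q)))
         (T : 'M[C]_(tau (p * q), tau p * tau q)),
    [/\ opnorm S <= 1, opnorm T <= 1 &
        tensmx (lam a) (lam b) = S *m lam (fun t => tensmx (a t) (b t)) *m T].

Record standing_conditions : Prop := {
  lambda_arity_gt0 : (0 < m)%N;
  lambda_size_gt0 : forall k, (0 < k)%N -> (0 < tau k)%N;
  lambda_multilinearity : lambda_multilinear;
  lambda_N1 : condN1;
  lambda_N2 : condN2;
  lambda_E1 : condE1;
  lambda_E2 : condE2;
  lambda_E3 : condE3;
  lambda_W1 : condW1;
  lambda_W2 : condW2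
}.

Definition condO1 : Prop := forall r (i j : 'I_m -> nat), (0 < r)%N ->
  (forall t, (1 <= i t <= r) && (1 <= j t <= r))%N ->
  lam (fun t => eps R r (i t) (j t)) = (lam (fun t => eps R r (j t) (i t)))^t*.

Definition condO2_eq r (P : 'M[C]_(tau r + tau r, tau (r + r))) : Prop :=
  forall i j : 'I_m -> nat,
    (forall t, ((1 <= i t <= r) && (r + 1 <= j t <= r + r) ||
                (r + 1 <= i t <= r + r) && (1 <= j t <= r))%N) ->
    P *m lam (fun t => eps R (r + r) (i t) (j t)) *m P^t* =
    block_mx 0 (lam (fun t => eps R r (i t) (j t - r)))
             (lam (fun t => eps R r (i t - r) (j t))) 0.

Definition condO2 : Prop := forall r, (0 < r)%N ->
  exists P : 'M[C]_(tau r + tau r, tau (r + r)),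
    [/\ opnorm P <= 1, condE2_eq P & condO2_eq P].

End LambdaConditions.

Section LambdaTensor.
Variables (R : realType) (m : nat) (tau : nat -> nat).
Local Notation C := R[i].
Variable lam : forall k, ('I_m -> 'M[C]_k) -> 'M[C]_(tau k).
Variable V : 'I_m -> lmodType C.

(* otimes_{lambda_k}, expanded on matrix units: f t = (i_t, j_t) runs over the   *)
(* positions in v_t. By [tens_lam_multilinear] and [tens_lamE] this is the      *)
(* m-linear map sending (alpha_t (x) x_t)_t to                                 *)
(* lambda_k(alpha_1, ..., alpha_m) (x) (x_1 (x) ... (x) x_m).                  *)
Definition tens_lam k (v : forall t, 'M[V t]_k) : 'M[tensor V]_(tau k) :=
  \matrix_(a, b) \sum_(f : {ffun 'I_m -> 'I_k * 'I_k})
    lam (fun t => delta_mx (f t).1 (f t).2) a b *: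
      tpure (fun t => v t (f t).1 (f t).2).

Lemma tens_lamE k (a : 'I_m -> 'M[C]_k) (x : forall t, V t) : (0 < k)%N ->
  multilinear (U := fun=> 'M[C]_k) (@lam k) ->
  tens_lam (fun t => elemV (a t) (x t)) = elemV (lam a) (tpure x).
Proof.
move=> k0 lamM; apply/matrixP => i j; rewrite !mxE.
have aE : a = fun t => \sum_(q : 'I_k * 'I_k) a t q.1 q.2 *: delta_mx q.1 q.2.
  by apply/funext => t; rewrite {1}[a t]matrix_sum_delta pair_bigA.
rewrite [in RHS]aE (multilinear_sum lamM); last by rewrite card_prod !card_ord muln_gt0 k0.
rewrite summxE scaler_suml; apply: eq_bigr => f _.
have -> : (fun t => elemV (a t) (x t) (f t).1 (f t).2) =
          (fun t => a t (f t).1 (f t).2 *: x t).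
  by apply/functional_extensionality_dep => t; rewrite mxE.
rewrite (multilinear_scale (@tpure_multilinear R m V)) !mxE scalerA.
by rewrite mulrC.
Qed.

Lemma tens_lam_multilinear k (v : forall t, 'M[V t]_k) t (c : C)
    (x y : 'M[V t]_k) :
  tens_lam (dfwith v t (scaleV c x + y)) =
  scaleV c (tens_lam (dfwith v t x)) + tens_lam (dfwith v t y).
Proof.
apply/matrixP => i j; rewrite !mxE scaler_sumr -big_split; apply: eq_bigr => f _ /=.
have E z : (fun s => dfwith v t z s (f s).1 (f s).2) =
    dfwith (fun s => v s (f s).1 (f s).2) t (z (f t).1 (f t).2).
  apply/functional_extensionality_dep => s.
  have [ts|ts] := eqVneq t s; first by case: s / ts; rewrite !dfwithin.
  by rewrite !dfwithout.
rewrite !E !mxE tpure_multilinear scalerDr !scalerA.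
by rewrite mulrC.
Qed.

Lemma tens_lam_star (s : forall t, V t -> V t) k n p (a : 'M[C]_(n, tau k))
    (v : forall t, 'M[V t]_k) (b : 'M[C]_(tau k, p)) : (0 < k)%N ->
  condO1 lam -> (forall t, antilinear (@s t)) ->
  starV (tstar s) (a *ml tens_lam v *mr b) =
  b^t* *ml tens_lam (fun t => starV (@s t) (v t)) *mr a^t*.
Proof.
move=> k0 lO1 sA; have tA := tstar_antilinear sA.
have t0 : tstar s 0 = 0.
  by have := tA (-1) 0 0; rewrite scaleN1r addNr rmorphN1 scaleN1r => ->; rewrite addNr.
have tsum (J : finType) (c : J -> C) (x : J -> tensor V) :
    tstar s (\sum_j c j *: x j) = \sum_j (c j)^* *: tstar s (x j).
  by elim/big_rec2: _ => [//|j y z _ <-]; rewrite tA.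
have deltaE (i j : 'I_k) : delta_mx i j = eps R k i.+1 j.+1.
  by apply/matrixP => x y; rewrite !mxE !eqSS.
have lamJ (f : {ffun 'I_m -> 'I_k * 'I_k}) i j :
    (lam (fun t => delta_mx (f t).1 (f t).2) j i)^* =
    lam (fun t => delta_mx (f t).2 (f t).1) i j.
  under [in LHS]eq_fun do rewrite deltaE.
  under [in RHS]eq_fun do rewrite deltaE.
  rewrite lO1 ?mxE ?conjCK // => t.
  by rewrite !ltn_ord.
have core i j : tstar s (tens_lam v j i) =
    tens_lam (fun t => starV (@s t) (v t)) i j.
  rewrite !mxE tsum.
  pose sw (f : {ffun 'I_m -> 'I_k * 'I_k}) := [ffun t => ((f t).2, (f t).1)].
  have swK : involutive sw.
    by move=> f; apply/ffunP => t; rewrite !ffunE -surjective_pairing.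
  rewrite [RHS](reindex_inj (inv_inj swK)); apply: eq_bigr => f _ /=.
  rewrite lamJ tstar_pure //; congr (lam _ i j *: tpure _).
    by apply/funext => t; rewrite ffunE.
  by apply/functional_extensionality_dep => t; rewrite !mxE ffunE.
apply/matrixP => i j; rewrite !mxE tsum.
under eq_bigr do rewrite mxE tsum scaler_sumr.
rewrite exchange_big; apply: eq_bigr => x _ /=.
rewrite !mxE scaler_sumr; apply: eq_bigr => y _.
by rewrite core !mxE !scalerA mulrC.
Qed.

Variable D : forall t, mo_structure (V t).

(* Under [condE1] the set below is never empty, so that [inf] is the infimum.  *)
Definition lambda_norm k (u : 'M[tensor V]_k) : R :=
  inf [set c : R | exists j (a : 'M[C]_(k, tau j)) (v : forall t, 'M[V t]_j)
      (b : 'M[C]_(tau j, k)),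
    [/\ (0 < j)%N, u = a *ml tens_lam v *mr b &
        c = opnorm a * (\prod_(t < m) mnorm (D t) (v t)) * opnorm b]].

Definition lambda_precone n : set 'M[tensor V]_n :=
  [set u | exists j (v : forall t, 'M[V t]_j) (a : 'M[C]_(n, tau j)),
    [/\ (0 < j)%N, forall t, mcone (D t) (v t) & u = a *ml tens_lam v *mr a^t*]].

(* By [tens_lam_star] the involution below is, on matrices, the one that sends   *)
(* a *ml tens_lam v *mr b to b^t* *ml tens_lam v' *mr a^t*, where v'_t is the     *)
(* adjoint of v_t.                                                             *)
Definition lambda_tensor : mo_structure (tensor V) := {|
  mnorm := lambda_norm;
  mstar := tstar (fun t => mstar (D t));
  mcone := fun n => norm_closure (@lambda_norm n) (@lambda_precone n)
|}.

End LambdaTensor.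

(* Main.v *)
(* The lambda-norm is a matrix norm because (E2) realises a pair of
   representations a1 (v) b1 and a2 (w) b2 inside the single tensor of the
   families v_t (+) w_t, and the same identity makes the cones additive. It is
   definite because products of bounded functionals are bounded for it, by (N2),
   and, by Hahn-Banach, finitely many vectors of each V_t are fixed by a bounded
   finite rank map, so that such products separate the points of the algebraic
   tensor product. (O1) makes the involution isometric. *)
Require Import Defs.
From mathcomp Require Import all_boot all_order all_algebra.
From mathcomp Require Import all_classical all_reals.
From mathcomp Require Import complex ring lra zify.

Set Implicit Arguments.
Unset Strict Implicit.
Unset Printing Implicit Defensive.

Import Order.TTheory GRing.Theory Num.Theory.

Local Open Scope classical_set_scope.
Local Open Scope ring_scope.
Local Open Scope sesquilinear_scope.

(** * The operator norm *)

(** Each representation of u only bounds its norm from above. To combine two of them without loss, a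
    representation is first balanced: for every c above the norm of u one may take all v_t
    contractive and both outer factors of norm at most sqrt c. Stacking outer factors of norms sqrt
    c and sqrt d gives norm at most sqrt (c + d), so bounds add; a diagonal block keeps a common
    bound. Positive lower bounds come from functionals. A bounded functional on V_t acts on every
    M_n(V_t) with the same constant, because scalar vectors x and y compress v in M_n(V_t) to the
    element y^* v x of V_t. Only the existence of bounded functionals matters, so their constants
    are not optimised. Hahn-Banach is reached through minimal sublinear functionals: one that cannot
    be lowered in any direction is odd, hence real linear, and no partial map on a subspace ever has
    to be extended. The cones are closures, so each cone axiom is checked on C_n and carried over by
    a Lipschitz estimate. *)

Section OperatorNorm.
Variable R : realType.
Local Notation C := R[i].
Local Notation normc := Normc.normc.

Lemma normcE (z : C) : `|z| = (normc z)%:C%C. Proof. by []. Qed.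

Lemma normc_ge0 (z : C) : 0 <= normc z.
Proof. by rewrite -lecR -normcE normr_ge0. Qed.

Lemma normc_conj (z : C) : normc z^* = normc z.
Proof. by apply: complexI; rewrite -!normcE norm_conjC. Qed.

Lemma normc_real (r : R) : normc (r%:C)%C = `|r|.
Proof. by rewrite /normc /= expr0n addr0 sqrtr_sqr. Qed.

Lemma normc_sum (I : finType) (F : I -> C) :
  normc (\sum_i F i) <= \sum_i normc (F i).
Proof.
elim/big_ind2: _ => [|x a y b xa yb|//]; first by rewrite Normc.normc0.
by apply: le_trans (le_normcD _ _) _; apply: lerD.
Qed.

Lemma normc_prod (I : finType) (F : I -> C) :
  normc (\prod_i F i) = \prod_i normc (F i).
Proof. by apply: (big_morph _ (@Normc.normcM R) (@Normc.normc1 R)). Qed.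

(** Lagrange's identity: twice the difference of the squared sides is the double sum of the squares
    (a_i b_j - a_j b_i)^2. *)
Lemma sum_mul_le_sqrt (I : finType) (a b : I -> R) :
  \sum_i a i * b i <= Num.sqrt (\sum_i a i ^+ 2) * Num.sqrt (\sum_i b i ^+ 2).
Proof.
have sq0 (c : I -> R) : 0 <= \sum_i c i ^+ 2 by apply: sumr_ge0 => i _; rewrite sqr_ge0.
rewrite -sqrtrM // (le_trans (ler_norm _)) // -sqrtr_sqr ler_wsqrtr //.
rewrite -subr_ge0 -(pmulr_rge0 _ (ltr0n R 2)) mulrBr expr2.
suff -> : 2 * ((\sum_i a i ^+ 2) * (\sum_i b i ^+ 2)) -
  2 * ((\sum_i a i * b i) * (\sum_i a i * b i)) =
  \sum_i \sum_j (a i * b j - a j * b i) ^+ 2.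
  by apply: sumr_ge0 => i _; apply: sumr_ge0 => j _; rewrite sqr_ge0.
have prodE (c d : I -> R) : (\sum_i c i) * (\sum_i d i) = \sum_i \sum_j c i * d j.
  by rewrite mulr_suml; apply: eq_bigr => i _; rewrite mulr_sumr.
transitivity ((\sum_i a i ^+ 2) * (\sum_i b i ^+ 2)
   + (\sum_i b i ^+ 2) * (\sum_i a i ^+ 2)
   - 2 * ((\sum_i a i * b i) * (\sum_i a i * b i))); first by ring.
rewrite !prodE mulr_sumr -sumrN -!big_split; apply: eq_bigr => i _ /=.
rewrite mulr_sumr -sumrN -!big_split; apply: eq_bigr => j _ /=; ring.
Qed.

Lemma l2norm_ge0 n (x : 'cV[C]_n) : 0 <= l2norm x.
Proof. exact: sqrtr_ge0. Qed.

Lemma sqr_l2norm n (x : 'cV[C]_n) : l2norm x ^+ 2 = \sum_i normc (x i 0) ^+ 2.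
Proof. by rewrite sqr_sqrtr //; apply: sumr_ge0 => i _; rewrite sqr_ge0. Qed.

Lemma l2normZ n c (x : 'cV[C]_n) : l2norm (c *: x) = normc c * l2norm x.
Proof.
apply: (pexpIrn (ltn0Sn 1)); rewrite ?nnegrE ?mulr_ge0 ?l2norm_ge0 ?normc_ge0 //.
rewrite exprMn !sqr_l2norm mulr_sumr; apply: eq_bigr => i _.
by rewrite mxE Normc.normcM exprMn.
Qed.

Lemma l2norm0 n : l2norm (0 : 'cV[C]_n) = 0.
Proof. by rewrite -(scale0r 0) l2normZ Normc.normc0 mul0r. Qed.

Lemma l2norm_eq0 n (x : 'cV[C]_n) : l2norm x = 0 -> x = 0.
Proof.
move=> /(congr1 (fun z => z ^+ 2)); rewrite sqr_l2norm expr0n /= => /eqP.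
rewrite psumr_eq0 => [/allP h|i _]; last by rewrite sqr_ge0.
apply/matrixP => i j; rewrite ord1 mxE.
have := h i; rewrite mem_index_enum sqrf_eq0 => /(_ isT)/eqP.
exact: Normc.eq0_normc.
Qed.

Lemma CauchySchwarz_l2 n (x y : 'cV[C]_n) :
  normc ((y^t* *m x) 0 0) <= l2norm y * l2norm x.
Proof.
rewrite mxE (le_trans (normc_sum _)) //.
apply: le_trans (sum_mul_le_sqrt (fun i => normc (y i 0)) (fun i => normc (x i 0))).
by apply: ler_sum => i _; rewrite !mxE Normc.normcM normc_conj.
Qed.

Lemma l2norm_dotE n (x : 'cV[C]_n) : (x^t* *m x) 0 0 = (l2norm x ^+ 2)%:C%C.
Proof.
rewrite sqr_l2norm rmorph_sum mxE; apply: eq_bigr => i _.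
by rewrite !mxE rmorphXn /= -normcE normCK mulrC.
Qed.

Lemma l2norm_le n (x : 'cV[C]_n) c : 0 <= c ->
  (forall y, normc ((y^t* *m x) 0 0) <= c * l2norm y) -> l2norm x <= c.
Proof.
move=> c0 /(_ x); rewrite l2norm_dotE normc_real ger0_norm ?sqr_ge0 // expr2.
have [-> //|x0] := eqVneq (l2norm x) 0.
by rewrite ler_pM2r // lt0r x0 l2norm_ge0.
Qed.

Lemma l2norm_col_mx n p (x : 'cV[C]_n) (y : 'cV[C]_p) :
  l2norm (col_mx x y) ^+ 2 = l2norm x ^+ 2 + l2norm y ^+ 2.
Proof.
rewrite !sqr_l2norm big_split_ord /=; congr (_ + _); apply: eq_bigr => i _.
  by rewrite col_mxEu.
by rewrite col_mxEd.
Qed.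

(** The Frobenius norm is a bound. Without boundedness [sup] would take its default value and
    [opnorm] would carry no information. *)
Let opnorm_ubound k l (A : 'M[C]_(k, l)) :
  has_ubound [set l2norm (A *m x) | x in [set x | l2norm x <= 1]].
Proof.
exists (Num.sqrt (\sum_i (\sum_j normc (A i j) ^+ 2))) => _ [x /= x1 <-].
apply: ler_wsqrtr; apply: ler_sum => i _.
have r0 : 0 <= \sum_j normc (A i j) ^+ 2 by apply: sumr_ge0 => j _; rewrite sqr_ge0.
rewrite -[leRHS]sqr_sqrtr // ler_pXn2r ?nnegrE ?normc_ge0 ?sqrtr_ge0 //.
rewrite mxE (le_trans (normc_sum _)) //.
rewrite (eq_bigr (fun j => normc (A i j) * normc (x j 0))) => [|j _]; last first.
  by rewrite Normc.normcM.
apply: le_trans (sum_mul_le_sqrt (fun j => normc (A i j)) (fun j => normc (x j 0))) _.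
by rewrite -[leRHS]mulr1 ler_wpM2l ?sqrtr_ge0.
Qed.

Lemma opnorm_ge0 k l (A : 'M[C]_(k, l)) : 0 <= opnorm A.
Proof.
apply: (ub_le_sup (opnorm_ubound A)); exists 0 => /=; first by rewrite l2norm0.
by rewrite mulmx0 l2norm0.
Qed.

Lemma l2norm_mulmx k l (A : 'M[C]_(k, l)) x : l2norm (A *m x) <= opnorm A * l2norm x.
Proof.
have [/l2norm_eq0 ->|x0] := eqVneq (l2norm x) 0.
  by rewrite mulmx0 !l2norm0 mulr0.
have xp : 0 < l2norm x by rewrite lt0r x0 l2norm_ge0.
rewrite -ler_pdivrMr // mulrC.
have -> : (l2norm x)^-1 = normc ((l2norm x)^-1)%:C%C.
  by rewrite normc_real ger0_norm // invr_ge0 ltW.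
rewrite -l2normZ scalemxAr; apply: (ub_le_sup (opnorm_ubound A)).
eexists; last by [].
by rewrite /= l2normZ normc_real ger0_norm ?invr_ge0 ?(ltW xp) // mulVf.
Qed.

Lemma opnorm_le k l (A : 'M[C]_(k, l)) c : 0 <= c ->
  (forall x, l2norm (A *m x) <= c * l2norm x) -> opnorm A <= c.
Proof.
move=> c0 h; apply: ge_sup.
  by exists 0, 0 => /=; rewrite ?l2norm0 ?ler01 // mulmx0 l2norm0.
by move=> _ [x /= x1 <-]; apply: le_trans (h x) _; rewrite -[leRHS]mulr1 ler_wpM2l.
Qed.

Lemma opnormM k l n (A : 'M[C]_(k, l)) (B : 'M[C]_(l, n)) :
  opnorm (A *m B) <= opnorm A * opnorm B.
Proof.
apply: opnorm_le => [|x]; first by rewrite mulr_ge0 ?opnorm_ge0.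
rewrite -mulmxA (le_trans (l2norm_mulmx _ _)) // -mulrA.
by rewrite ler_wpM2l ?opnorm_ge0 // l2norm_mulmx.
Qed.

Lemma opnormZ k l c (A : 'M[C]_(k, l)) : opnorm (c *: A) <= normc c * opnorm A.
Proof.
apply: opnorm_le => [|x]; first by rewrite mulr_ge0 ?normc_ge0 ?opnorm_ge0.
rewrite -scalemxAl l2normZ -mulrA.
by rewrite ler_wpM2l ?normc_ge0 // l2norm_mulmx.
Qed.

Lemma opnorm0 k l : opnorm (0 : 'M[C]_(k, l)) = 0.
Proof.
apply/le_anti; rewrite opnorm_ge0 andbT; apply: opnorm_le => // x.
by rewrite mul0mx l2norm0 mul0r.
Qed.

Lemma opnorm1 k : opnorm (1%:M : 'M[C]_k) <= 1.
Proof. by apply: opnorm_le => // x; rewrite mul1mx mul1r. Qed.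

Lemma adjmxE k l (A : 'M[C]_(k, l)) i j : (A^t*) i j = (A j i)^*.
Proof. by rewrite !mxE. Qed.

Lemma adjmxM k l n (A : 'M[C]_(k, l)) (B : 'M[C]_(l, n)) :
  (A *m B)^t* = B^t* *m A^t*.
Proof. by rewrite trmx_mul map_mxM. Qed.

Lemma adjmxK k l (A : 'M[C]_(k, l)) : (A^t*)^t* = A.
Proof. by apply/matrixP => i j; rewrite !mxE conjCK. Qed.

Lemma adj_row_mx k n p (A : 'M[C]_(k, n)) (B : 'M[C]_(k, p)) :
  (row_mx A B)^t* = col_mx (A^t*) (B^t*).
Proof. by rewrite tr_row_mx map_col_mx. Qed.

(** By duality, |<y, A^* x>| = |<x, A y>| gives one inequality; applied to A^* it gives the
    other. *)
Lemma opnorm_adj k l (A : 'M[C]_(k, l)) : opnorm (A^t*) = opnorm A.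
Proof.
suff le p q (B : 'M[C]_(p, q)) : opnorm (B^t*) <= opnorm B.
  by apply/le_anti; rewrite le -{1}[A]adjmxK le.
move: p q B => {}k {}l {}A; apply: opnorm_le => [|x]; first exact: opnorm_ge0.
apply: l2norm_le => [|y]; first by rewrite mulr_ge0 ?opnorm_ge0 ?l2norm_ge0.
have -> : normc ((y^t* *m (A^t* *m x)) 0 0) = normc ((x^t* *m (A *m y)) 0 0).
  have -> : x^t* *m (A *m y) = (y^t* *m (A^t* *m x))^t* by rewrite !adjmxM !adjmxK mulmxA.
  by rewrite adjmxE normc_conj.
apply: le_trans (CauchySchwarz_l2 _ _) _; rewrite mulrAC mulrC ler_wpM2r ?l2norm_ge0 //.
exact: l2norm_mulmx.
Qed.

(** The quadratic bound, rather than the sum of the two norms, is what makes the constants of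
    balanced representations add exactly. *)
Lemma opnorm_col_mx n p k (A : 'M[C]_(n, k)) (B : 'M[C]_(p, k)) :
  opnorm (col_mx A B) <= Num.sqrt (opnorm A ^+ 2 + opnorm B ^+ 2).
Proof.
have s0 : 0 <= opnorm A ^+ 2 + opnorm B ^+ 2 by rewrite addr_ge0 ?sqr_ge0.
apply: opnorm_le => [|x]; first exact: sqrtr_ge0.
rewrite -(ler_pXn2r (ltn0Sn 1)) ?nnegrE ?mulr_ge0 ?sqrtr_ge0 ?l2norm_ge0 //.
rewrite mul_col_mx l2norm_col_mx exprMn (sqr_sqrtr s0) mulrDl -!exprMn.
by apply: lerD; rewrite ler_pXn2r ?nnegrE ?mulr_ge0 ?opnorm_ge0 ?l2norm_ge0 // l2norm_mulmx.
Qed.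

Lemma opnorm_row_mx n p k (A : 'M[C]_(k, n)) (B : 'M[C]_(k, p)) :
  opnorm (row_mx A B) <= Num.sqrt (opnorm A ^+ 2 + opnorm B ^+ 2).
Proof.
rewrite -[opnorm A]opnorm_adj -[opnorm B]opnorm_adj -opnorm_adj adj_row_mx.
exact: opnorm_col_mx.
Qed.

Lemma opnorm_diag_block n p k l (A : 'M[C]_(n, k)) (B : 'M[C]_(p, l)) :
  opnorm (block_mx A 0 0 B) <= Num.max (opnorm A) (opnorm B).
Proof.
have m0 : 0 <= Num.max (opnorm A) (opnorm B) by rewrite le_max opnorm_ge0.
apply: opnorm_le => // x.
rewrite -(ler_pXn2r (ltn0Sn 1)) ?nnegrE ?mulr_ge0 ?l2norm_ge0 //.
rewrite -[x]vsubmxK mul_block_col !mul0mx addr0 add0r exprMn !l2norm_col_mx mulrDr -!exprMn.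
apply: lerD; rewrite ler_pXn2r ?nnegrE ?mulr_ge0 ?opnorm_ge0 ?l2norm_ge0 //.
  by rewrite (le_trans (l2norm_mulmx _ _)) // ler_wpM2r ?l2norm_ge0 // le_max lexx.
by rewrite (le_trans (l2norm_mulmx _ _)) // ler_wpM2r ?l2norm_ge0 // le_max lexx orbT.
Qed.

Lemma opnorm_colV n (x : 'cV[C]_n) : opnorm x <= l2norm x.
Proof.
apply: opnorm_le => [|c]; first exact: l2norm_ge0.
have -> : l2norm c = normc (c 0 0).
  by rewrite /l2norm big_ord1 sqrtr_sqr ger0_norm ?normc_ge0.
suff -> : x *m c = c 0 0 *: x by rewrite l2normZ mulrC.
by apply/matrixP => i j; rewrite !mxE big_ord1 !ord1 mulrC.
Qed.

Lemma normc_le_opnorm k l (A : 'M[C]_(k, l)) i j : normc (A i j) <= opnorm A.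
Proof.
have le1 p (q : 'I_p) : l2norm (delta_mx q 0 : 'cV[C]_p) <= 1.
  rewrite -[leRHS]sqrtr1 ler_wsqrtr // (bigD1 q) //= big1 => [|s /negbTE sq].
    by rewrite mxE !eqxx Normc.normc1 expr1n addr0.
  by rewrite mxE sq Normc.normc0 expr0n.
have -> : A i j = ((delta_mx i 0 : 'cV_k)^t* *m (A *m delta_mx j 0 : 'cV_k)) 0 0.
  rewrite -colE mxE (bigD1 i) //= big1 ?addr0 => [|s /negbTE sq].
    by rewrite !mxE !eqxx rmorph1 mul1r.
  by rewrite !mxE sq rmorph0 mul0r.
apply: le_trans (CauchySchwarz_l2 _ _) _.
apply: le_trans (ler_pM (l2norm_ge0 _) (l2norm_ge0 _) (le1 _ _) (l2norm_mulmx _ _)) _.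
by rewrite mul1r -[leRHS]mulr1 ler_wpM2l ?opnorm_ge0.
Qed.

End OperatorNorm.

(** * Bounded functionals *)

Section HahnBanach.
Variables (R : realType) (W : lmodType R[i]).
Local Notation C := R[i].
Local Notation normc := Normc.normc.

(** The axioms are inequalities, with positive scalars only, because this form passes directly to
    pointwise infima; [sublinear0] and [sublinear_scale] recover the equalities. *)
Record sublinear (q : W -> R) : Prop := {
  sublinearD : forall x y, q (x + y) <= q x + q y;
  sublinearZ : forall r x, 0 < r -> q ((r%:C)%C *: x) <= r * q x;
  sublinear_le0 : q 0 <= 0
}.

Lemma sublinear0 q : sublinear q -> q 0 = 0.
Proof.
by case=> qD _ q0; have := qD 0 0; rewrite addr0 => h; apply/le_anti; rewrite q0 /=; lra.
Qed.

Lemma sublinear_geN q x : sublinear q -> - q (- x) <= q x.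
Proof.
move=> qS; have := sublinearD qS x (- x); rewrite subrr (sublinear0 qS); lra.
Qed.

Lemma sublinear_scale q r x : sublinear q -> 0 <= r -> q ((r%:C)%C *: x) = r * q x.
Proof.
move=> qS; rewrite le_eqVlt => /predU1P[<-|r0].
  by rewrite scale0r mul0r sublinear0.
apply/le_anti; rewrite (sublinearZ qS) //=.
have := sublinearZ qS ((r%:C)%C *: x) (_ : 0 < r^-1).
rewrite invr_gt0 r0 scalerA -rmorphM /= mulVf ?gt_eqF // scale1r => /(_ isT).
by rewrite -ler_pdivrMl ?invr_gt0 // invrK.
Qed.

(** Subadditivity and homogeneity may move from one member of F to another, so the members need not
    be sublinear themselves; b keeps the infimum from taking a default value. It serves both the
    lowering of a functional and the infimum of a chain. *)
Lemma sublinear_inf (F : set (W -> R)) (b : W -> R) :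
  (forall g x, F g -> b x <= g x) ->
  (forall g h x y, F g -> F h -> exists2 k, F k & k (x + y) <= g x + h y) ->
  (forall g r x, F g -> 0 < r -> exists2 k, F k & k ((r%:C)%C *: x) <= r * g x) ->
  (exists2 g, F g & g 0 <= 0) ->
  sublinear (fun x => inf [set g x | g in F]) /\
  (forall g x, F g -> inf [set g x | g in F] <= g x).
Proof.
move=> bF FD FZ [g0 Fg0 g00].
have lb x : has_lbound [set g x | g in F] by exists (b x) => _ [g Fg <-]; exact: bF.
have le g x : F g -> inf [set g x | g in F] <= g x.
  by move=> Fg; apply: (ge_inf (lb x)); exists g.
have ne x : [set g x | g in F] !=set0 by exists (g0 x), g0.
split=> //; split=> [x y|r x r0|]; last by apply: le_trans (le _ _ Fg0) g00.
- rewrite -lerBlDr; apply: lb_le_inf => // _ [g Fg <-].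
  rewrite lerBlDr -lerBlDl; apply: lb_le_inf => // _ [h Fh <-].
  rewrite lerBlDl; have [k Fk] := FD g h x y Fg Fh.
  by apply: le_trans; exact: le.
- rewrite -ler_pdivrMl //; apply: lb_le_inf => // _ [g Fg <-].
  rewrite ler_pdivrMl //; have [k Fk] := FZ g r x Fg r0.
  by apply: le_trans; exact: le.
Qed.

(** Take q' x as the infimum over t >= 0 of q (x + t w) - t q w. It is finite since q (t w) <= q (x
    + t w) + q (- x); t = 0 gives q' <= q, and t = 1 gives the value at - w. *)
Lemma sublinear_lower q w : sublinear q ->
  exists q', [/\ sublinear q', forall x, q' x <= q x & q' (- w) <= - q w].
Proof.
move=> qS.
pose g t x := q (x + (t%:C)%C *: w) - t * q w.
pose F := [set g t | t in [set t | 0 <= t]].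
have [] := @sublinear_inf F (fun x => - q (- x)).
- move=> _ x [t /= t0 <-]; rewrite /g -(sublinear_scale _ qS) //.
  by have := sublinearD qS (x + (t%:C)%C *: w) (- x); rewrite addrC addrA addNr add0r; lra.
- move=> _ _ x y [t /= t0 <-] [s /= s0 <-]; exists (g (t + s)).
    by exists (t + s) => //=; rewrite addr_ge0.
  rewrite /g rmorphD scalerDl addrACA mulrDl.
  by have := sublinearD qS (x + (t%:C)%C *: w) (y + (s%:C)%C *: w); rewrite /=; lra.
- move=> _ r x [t /= t0 <-] r0; exists (g (r * t)).
    by exists (r * t) => //=; rewrite mulr_ge0 ?(ltW r0).
  by rewrite /g mulrBr -(sublinear_scale (x + _) qS (ltW r0)) scalerDr scalerA -rmorphM mulrA.
- exists (g 0); first by exists 0 => /=.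
  by rewrite /g scale0r addr0 mul0r subr0 sublinear0.
move=> S le; exists (fun x => inf [set g x | g in F]); split=> // [x|].
  apply: le_trans (le (g 0) x _) _; first by exists 0 => /=.
  by rewrite /g scale0r addr0 mul0r subr0.
apply: le_trans (le (g 1) _ _) _; first by exists 1 => //=; rewrite ler01.
by rewrite /g scale1r addNr mul1r (sublinear0 qS) add0r.
Qed.

(** Zorn's lemma for the reversed pointwise order, so that its maximal elements are minimal
    functionals. A chain is bounded by its infimum, which is finite because g x >= - g (- x) >= - p
    (- x). *)
Lemma sublinear_minimal p : sublinear p ->
  exists q, [/\ sublinear q, forall x, q x <= p x &
    forall q', sublinear q' -> (forall x, q' x <= q x) -> q' = q].
Proof.
move=> pS; pose T := {q | sublinear q /\ forall x, q x <= p x}.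
pose le (s t : T) : bool := `[< forall x, sval t x <= sval s x >].
have [|||A Atot|[q [qS qp]] qmin] := @Zorn T le.
- by move=> t; apply/asboolP.
- move=> r s t /asboolP rs /asboolP st; apply/asboolP => x.
  exact: le_trans (st x) (rs x).
- move=> [s sP] [t tP] /asboolP /= st /asboolP /= ts.
  by apply: eq_exist; apply/funext => x; apply/le_anti; rewrite st ts.
(* The empty chain has no infimum to offer; p itself bounds it. *)
- have [[a Aa]|A0] := pselect (exists a, A a); last first.
    exists (exist _ p (conj pS (fun x => lexx (p x)))) => s As.
    by case: A0; exists s.
  pose F := [set sval s | s in A].
  have [] := @sublinear_inf F (fun x => - p (- x)).
  + move=> _ x [[g [gS gp]] Ag <-] /=.
    by apply: le_trans (sublinear_geN x gS); rewrite lerN2.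
  + move=> _ _ x y [g Ag <-] [h Ah <-].
    have [/asboolP|/asboolP] := Atot g h Ag Ah => gh.
      exists (sval h); first by exists h.
      by apply: le_trans (sublinearD (svalP h).1 x y) _; rewrite lerD2r.
    exists (sval g); first by exists g.
    by apply: le_trans (sublinearD (svalP g).1 x y) _; rewrite lerD2l.
  + move=> _ r x [g Ag <-] r0; exists (sval g); first by exists g.
    exact: (sublinearZ (svalP g).1).
  + by exists (sval a); [exists a | exact: (sublinear_le0 (svalP a).1)].
  move=> S infle; pose q x := inf [set g x | g in F].
  have qp x : q x <= p x.
    apply: le_trans (infle (sval a) x _) ((svalP a).2 x).
    by exists a.
  exists (exist _ q (conj S qp)) => s As; apply/asboolP => x /=.
  by apply: infle; exists s.
exists q; split=> // q' q'S q'q.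
have q'p x : q' x <= p x := le_trans (q'q x) (qp x).
have /qmin : le (exist _ q (conj qS qp)) (exist _ q' (conj q'S q'p)).
  exact/asboolP.
by move=> /(congr1 sval).
Qed.

(** Lowering p at w first forces q (- w) <= - p w on every functional below. A minimal q equals each
    of its own lowerings, so q (- y) <= - q y for all y; oddness turns subadditivity into
    additivity. *)
Lemma sublinear_real_linear p w : sublinear p ->
  exists q : W -> R, [/\ forall x y, q (x + y) = q x + q y,
    forall r x, q ((r%:C)%C *: x) = r * q x,
    forall x, q x <= p x & p w <= q w].
Proof.
move=> /(@sublinear_lower p w)[p' [p'S p'p p'w]].
have [q [qS qp' qmin]] := sublinear_minimal p'S.
have qN y : q (- y) = - q y.
  have [q' [q'S q'q q'y]] := sublinear_lower y qS.
  apply/le_anti; rewrite -{1}(qmin q' q'S q'q) q'y /=.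
  by rewrite lerNl; exact: sublinear_geN.
exists q; split=> [x y|r x|x|].
- apply/le_anti; rewrite (sublinearD qS) /=.
  by have := sublinearD qS (x + y) (- y); rewrite addrK qN; lra.
- have [r0|r0] := leP 0 r; first exact: sublinear_scale.
  rewrite -[LHS]opprK -qN -scaleNr -rmorphN sublinear_scale ?oppr_ge0 ?(ltW r0) //.
  by rewrite mulNr opprK.
- exact: le_trans (p'p x).
- by rewrite -[q w]opprK lerNr -qN; apply: le_trans p'w.
Qed.

(* The real part q of the functional determines it as x |-> q x - i q (i x). *)
Lemma separating_functional (p : W -> R) (w : W) :
  (forall x y, p (x + y) <= p x + p y) ->
  (forall c x, p (c *: x) = normc c * p x) -> 0 < p w ->
  exists (f : W -> C^o) (K : R), [/\ linear f, f w = 1, 0 <= K &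
    forall x, normc (f x) <= K * p x].
Proof.
move=> pD pZ pw.
have pS : sublinear p.
  split=> // [r x r0|]; first by rewrite pZ normc_real gtr0_norm.
  by rewrite -(scale0r 0) pZ Normc.normc0 mul0r.
have [q [qD qZ qp qw]] := sublinear_real_linear w pS.
pose f (x : W) : C^o := Complex (q x) (- q ('i%C *: x)).
have q_abs x : `|q x| <= p x.
  rewrite ler_norml qp andbT lerNl.
  have -> : - q x = q (- x) by rewrite -scaleN1r -(rmorphN1 (real_complex R)) qZ mulN1r.
  apply: le_trans (qp _) _; rewrite -scaleN1r pZ normcN Normc.normc1 mul1r.
  exact: lexx.
have fL : linear f.
  move=> c x y; rewrite /f.
  have split_c z : q (c *: z) = complex.Re c * q z + complex.Im c * q ('i%C *: z).
    rewrite {1}[c]complexE scalerDl qD qZ [X in X *: z]mulrC -scalerA qZ.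
    by [].
  have ii z : q ('i%C *: ('i%C *: z)) = - q z.
    rewrite scalerA -expr2 sqr_i -(rmorphN1 (real_complex R)) qZ mulN1r //.
  rewrite scalerDr !qD scalerA ['i%C * c]mulrC -scalerA !split_c ii.
  rewrite [RHS](_ : _ = c * Complex (q x) (- q ('i%C *: x)) +
     Complex (q y) (- q ('i%C *: y))) //.
  by case: c {split_c} => a b; simpc => /=; congr Complex; ring.
have fw0 : f w != 0.
  apply/eqP => /(congr1 (@complex.Re R)) /= q0.
  by move: qw; rewrite q0 leNgt pw.
(* The real and the imaginary part are each at most p x in absolute value; their sum gives the 2. *)
have fb x : normc (f x) <= 2 * p x.
  have -> : f x = (q x)%:C%C + 'i%C * (- q ('i%C *: x))%:C%C by rewrite {1}[f x]complexE.
  apply: le_trans (le_normcD _ _) _.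
  rewrite Normc.normcM !normc_real normrN mulr2n mulrDl mul1r lerD //.
  have i1 : normc 'i%C = 1 :> R by rewrite /= expr0n add0r expr1n sqrtr1.
  by rewrite i1 mul1r (le_trans (q_abs _)) // pZ i1 mul1r.
exists (fun x => (f w)^-1 * f x), ((normc (f w))^-1 * 2); split.
- by move=> c x y; rewrite fL mulrDr; congr (_ + _); rewrite mulrCA.
- by rewrite mulVf.
- by rewrite mulr_ge0 ?invr_ge0 ?normc_ge0.
- by move=> x; rewrite Normc.normcM Normc.normcV -mulrA ler_wpM2l ?invr_ge0 ?normc_ge0.
Qed.

End HahnBanach.

(** * Amplifications *)

Section AmplificationTheory.
Variables (R : realType) (V : lmodType R[i]).
Local Notation C := R[i].

Lemma lmulVA p n q r (a : 'M[C]_(p, n)) (b : 'M[C]_(n, q)) (v : 'M[V]_(q, r)) :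
  a *ml (b *ml v) = (a *m b) *ml v.
Proof.
apply/matrixP => i j; rewrite !mxE.
under eq_bigr do rewrite mxE scaler_sumr.
rewrite exchange_big; apply: eq_bigr => k _; rewrite mxE scaler_suml.
by apply: eq_bigr => l _; rewrite scalerA.
Qed.

Lemma rmulVA p n q r (v : 'M[V]_(p, n)) (a : 'M[C]_(n, q)) (b : 'M[C]_(q, r)) :
  v *mr a *mr b = v *mr (a *m b).
Proof.
apply/matrixP => i j; rewrite !mxE.
under eq_bigr do rewrite mxE scaler_sumr.
rewrite exchange_big; apply: eq_bigr => k _; rewrite mxE scaler_suml.
by apply: eq_bigr => l _; rewrite scalerA mulrC.
Qed.

Lemma lmulV_rmulV p n q r (a : 'M[C]_(p, n)) (v : 'M[V]_(n, q)) (b : 'M[C]_(q, r)) :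
  a *ml (v *mr b) = a *ml v *mr b.
Proof.
apply/matrixP => i j; rewrite !mxE.
under eq_bigr do rewrite mxE scaler_sumr.
rewrite exchange_big; apply: eq_bigr => k _; rewrite mxE scaler_sumr.
by apply: eq_bigr => l _; rewrite !scalerA mulrC.
Qed.

Lemma mulV_sandwich p n q r s t (a : 'M[C]_(p, n)) (b : 'M[C]_(n, q))
    (v : 'M[V]_(q, r)) (c : 'M[C]_(r, s)) (d : 'M[C]_(s, t)) :
  a *ml (b *ml v *mr c) *mr d = (a *m b) *ml v *mr (c *m d).
Proof. by rewrite lmulV_rmulV lmulVA rmulVA. Qed.

Lemma lmul1V p q (v : 'M[V]_(p, q)) : 1%:M *ml v = v.
Proof.
apply/matrixP => i j; rewrite mxE (bigD1 i) //= mxE eqxx scale1r big1 ?addr0 // => k.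
by rewrite mxE eq_sym => /negbTE ->; rewrite scale0r.
Qed.

Lemma rmulV1 p q (v : 'M[V]_(p, q)) : v *mr 1%:M = v.
Proof.
apply/matrixP => i j; rewrite mxE (bigD1 j) //= mxE eqxx scale1r big1 ?addr0 // => k.
by rewrite mxE => /negbTE ->; rewrite scale0r.
Qed.

Lemma lmulV_sum p n q (I : finType) (a : 'M[C]_(p, n)) (v : I -> 'M[V]_(n, q)) :
  a *ml (\sum_i v i) = \sum_i a *ml v i.
Proof.
apply/matrixP => i j; rewrite summxE !mxE.
under eq_bigr do rewrite summxE scaler_sumr.
by rewrite exchange_big; apply: eq_bigr => k _; rewrite mxE.
Qed.

Lemma rmulV_sum p n q (I : finType) (v : I -> 'M[V]_(p, n)) (b : 'M[C]_(n, q)) :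
  (\sum_i v i) *mr b = \sum_i v i *mr b.
Proof.
apply/matrixP => i j; rewrite summxE !mxE.
under eq_bigr do rewrite summxE scaler_sumr.
by rewrite exchange_big; apply: eq_bigr => k _; rewrite mxE.
Qed.

Lemma lmul_elemV p n q (a : 'M[C]_(p, n)) (b : 'M[C]_(n, q)) (x : V) :
  a *ml elemV b x = elemV (a *m b) x.
Proof.
apply/matrixP => i j; rewrite !mxE scaler_suml; apply: eq_bigr => k _.
by rewrite mxE scalerA.
Qed.

Lemma rmul_elemV p n q (a : 'M[C]_(p, n)) (b : 'M[C]_(n, q)) (x : V) :
  elemV a x *mr b = elemV (a *m b) x.
Proof.
apply/matrixP => i j; rewrite !mxE scaler_suml; apply: eq_bigr => k _.
by rewrite mxE scalerA mulrC.
Qed.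

Lemma lmul0V p n q (v : 'M[V]_(n, q)) : (0 : 'M[C]_(p, n)) *ml v = 0.
Proof.
by apply/matrixP => i j; rewrite !mxE big1 // => k _; rewrite mxE scale0r.
Qed.

Lemma lmulV0 p n q (a : 'M[C]_(p, n)) : a *ml (0 : 'M[V]_(n, q)) = 0.
Proof.
by apply/matrixP => i j; rewrite !mxE big1 // => k _; rewrite mxE scaler0.
Qed.

Lemma rmul0V p n q (b : 'M[C]_(n, q)) : (0 : 'M[V]_(p, n)) *mr b = 0.
Proof.
by apply/matrixP => i j; rewrite !mxE big1 // => k _; rewrite mxE scaler0.
Qed.

Lemma rmulV0 p n q (v : 'M[V]_(p, n)) : v *mr (0 : 'M[C]_(n, q)) = 0.
Proof.
by apply/matrixP => i j; rewrite !mxE big1 // => k _; rewrite mxE scale0r.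
Qed.

Lemma lmulVB p n q (a : 'M[C]_(p, n)) (v w : 'M[V]_(n, q)) :
  a *ml (v - w) = a *ml v - a *ml w.
Proof.
apply/matrixP => i j; rewrite !mxE -sumrB.
by apply: eq_bigr => k _; rewrite !mxE scalerBr.
Qed.

Lemma rmulVB p n q (v w : 'M[V]_(p, n)) (b : 'M[C]_(n, q)) :
  (v - w) *mr b = v *mr b - w *mr b.
Proof.
apply/matrixP => i j; rewrite !mxE -sumrB.
by apply: eq_bigr => k _; rewrite !mxE scalerBr.
Qed.

Lemma lscale_mulV p n q c (a : 'M[C]_(p, n)) (v : 'M[V]_(n, q)) :
  (c *: a) *ml v = scaleV c (a *ml v).
Proof.
apply/matrixP => i j; rewrite !mxE scaler_sumr.
by apply: eq_bigr => k _; rewrite mxE scalerA.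
Qed.

Lemma scale_rmulV p n q c (v : 'M[V]_(p, n)) (b : 'M[C]_(n, q)) :
  scaleV c v *mr b = scaleV c (v *mr b).
Proof.
apply/matrixP => i j; rewrite !mxE scaler_sumr.
by apply: eq_bigr => k _; rewrite !mxE !scalerA mulrC.
Qed.

Lemma rscale_mulV p n q c (v : 'M[V]_(p, n)) (b : 'M[C]_(n, q)) :
  v *mr (c *: b) = scaleV c (v *mr b).
Proof.
apply/matrixP => i j; rewrite !mxE scaler_sumr.
by apply: eq_bigr => k _; rewrite mxE scalerA.
Qed.

Lemma lmulV_scale p n q c (a : 'M[C]_(p, n)) (v : 'M[V]_(n, q)) :
  a *ml scaleV c v = scaleV c (a *ml v).
Proof.
apply/matrixP => i j; rewrite !mxE scaler_sumr.
by apply: eq_bigr => k _; rewrite !mxE !scalerA mulrC.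
Qed.

Lemma scaleVA p q c d (v : 'M[V]_(p, q)) : scaleV c (scaleV d v) = scaleV (c * d) v.
Proof. by apply/matrixP => i j; rewrite !mxE scalerA. Qed.

Lemma scale1V p q (v : 'M[V]_(p, q)) : scaleV 1 v = v.
Proof. by apply/matrixP => i j; rewrite !mxE scale1r. Qed.

Lemma scale0V p q (v : 'M[V]_(p, q)) : scaleV 0 v = 0.
Proof. by apply/matrixP => i j; rewrite !mxE scale0r. Qed.

Lemma lmul_col_mx p p' n q (a : 'M[C]_(p, n)) (b : 'M[C]_(p', n)) (v : 'M[V]_(n, q)) :
  col_mx a b *ml v = col_mx (a *ml v) (b *ml v).
Proof.
apply/matrixP => i j; rewrite -(splitK i); case: (fintype.split i) => k /=.
  by rewrite col_mxEu !mxE; apply: eq_bigr => l _; rewrite col_mxEu.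
by rewrite col_mxEd !mxE; apply: eq_bigr => l _; rewrite col_mxEd.
Qed.

Lemma lmul_row_mx p n q q' (a : 'M[C]_(p, n)) (v : 'M[V]_(n, q)) (w : 'M[V]_(n, q')) :
  a *ml row_mx v w = row_mx (a *ml v) (a *ml w).
Proof.
apply/matrixP => i j; rewrite -[j]splitK; case: (fintype.split j) => k /=.
  by rewrite row_mxEl !mxE; apply: eq_bigr => l _; rewrite row_mxEl.
by rewrite row_mxEr !mxE; apply: eq_bigr => l _; rewrite row_mxEr.
Qed.

Lemma lmul_row_col p n n' q (a : 'M[C]_(p, n)) (b : 'M[C]_(p, n'))
    (v : 'M[V]_(n, q)) (w : 'M[V]_(n', q)) :
  row_mx a b *ml col_mx v w = a *ml v + b *ml w.
Proof.
apply/matrixP => i j; rewrite !mxE big_split_ord /=; congr (_ + _);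
  by apply: eq_bigr => k _; rewrite ?row_mxEl ?row_mxEr ?col_mxEu ?col_mxEd.
Qed.

Lemma rmul_row_mx p n q q' (v : 'M[V]_(p, n)) (a : 'M[C]_(n, q)) (b : 'M[C]_(n, q')) :
  v *mr row_mx a b = row_mx (v *mr a) (v *mr b).
Proof.
apply/matrixP => i j; rewrite -[j]splitK; case: (fintype.split j) => k /=.
  by rewrite row_mxEl !mxE; apply: eq_bigr => l _; rewrite row_mxEl.
by rewrite row_mxEr !mxE; apply: eq_bigr => l _; rewrite row_mxEr.
Qed.

Lemma rmul_col_mx p p' n q (v : 'M[V]_(p, n)) (w : 'M[V]_(p', n)) (b : 'M[C]_(n, q)) :
  col_mx v w *mr b = col_mx (v *mr b) (w *mr b).
Proof.
apply/matrixP => i j; rewrite -(splitK i); case: (fintype.split i) => k /=.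
  by rewrite col_mxEu !mxE; apply: eq_bigr => l _; rewrite col_mxEu.
by rewrite col_mxEd !mxE; apply: eq_bigr => l _; rewrite col_mxEd.
Qed.

Lemma rmul_row_col p n n' q (v : 'M[V]_(p, n)) (w : 'M[V]_(p, n'))
    (a : 'M[C]_(n, q)) (b : 'M[C]_(n', q)) :
  row_mx v w *mr col_mx a b = v *mr a + w *mr b.
Proof.
apply/matrixP => i j; rewrite !mxE big_split_ord /=; congr (_ + _);
  by apply: eq_bigr => k _; rewrite ?row_mxEl ?row_mxEr ?col_mxEu ?col_mxEd.
Qed.

(** Read from right to left, a sum of two sandwiches becomes one sandwich around a direct sum, which
    is the shape (E2) can absorb. *)
Lemma row_block_col p q n n' k k' (a : 'M[C]_(p, n)) (b : 'M[C]_(p, n'))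
    (v : 'M[V]_(n, k)) (w : 'M[V]_(n', k')) (c : 'M[C]_(k, q)) (d : 'M[C]_(k', q)) :
  row_mx a b *ml block_mx v 0 0 w *mr col_mx c d = a *ml v *mr c + b *ml w *mr d.
Proof.
rewrite /block_mx lmul_row_col !lmul_row_mx !lmulV0 add_row_mx addr0 add0r.
by rewrite rmul_row_col.
Qed.

Lemma block_block_block p p' q q' n n' k k' (a : 'M[C]_(p, n)) (b : 'M[C]_(p', n'))
    (v : 'M[V]_(n, k)) (w : 'M[V]_(n', k')) (c : 'M[C]_(k, q)) (d : 'M[C]_(k', q')) :
  block_mx a 0 0 b *ml block_mx v 0 0 w *mr block_mx c 0 0 d =
  block_mx (a *ml v *mr c) 0 0 (b *ml w *mr d).
Proof.
rewrite [block_mx a _ _ _]/block_mx lmul_col_mx rmul_col_mx [block_mx c _ _ _]block_mxEh.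
rewrite !rmul_row_mx !row_block_col.
by rewrite !(lmul0V, rmulV0, rmul0V) !addr0 !add0r.
Qed.

Lemma col_block_row n k (v : 'M[V]_n) :
  col_mx 1%:M 0 *ml v *mr row_mx 1%:M 0 = block_mx v 0 0 (0 : 'M[V]_k).
Proof.
by rewrite lmul_col_mx rmul_row_mx !rmul_col_mx !(lmul1V, lmul0V, rmulV1, rmulV0, rmul0V)
  block_mxEh.
Qed.

Lemma col_block_row_dr n k (v : 'M[V]_n) :
  col_mx 0 1%:M *ml v *mr row_mx 0 1%:M = block_mx (0 : 'M[V]_k) 0 0 v.
Proof.
by rewrite lmul_col_mx rmul_row_mx !rmul_col_mx !(lmul1V, lmul0V, rmulV1, rmulV0, rmul0V)
  block_mxEh.
Qed.

Lemma matrix_sum_elemV p q (v : 'M[V]_(p, q)) :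
  v = \sum_(x : 'I_p * 'I_q) elemV (delta_mx x.1 x.2) (v x.1 x.2).
Proof.
apply/matrixP => i j; rewrite summxE (bigD1 (i, j)) //= big1 => [|[k l] kl].
  by rewrite !mxE !eqxx scale1r addr0.
rewrite !mxE; have [ik|_] := eqVneq i k; last by rewrite scale0r.
have [jl|_] := eqVneq j l; last by rewrite scale0r.
by move: kl; rewrite xpair_eqE ik jl !eqxx.
Qed.

End AmplificationTheory.

(** * Operator spaces: functionals on matrix levels and bounded finite rank maps *)

Section OperatorSpaceTheory.
Variables (R : realType) (V : lmodType R[i]) (N : forall n, 'M[V]_n -> R).
Local Notation C := R[i].
Local Notation normc := Normc.normc.
Hypothesis NV : operator_space N.

Lemma os_norm0 n : (0 < n)%N -> N (0 : 'M[V]_n) = 0.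
Proof.
by move=> n0; rewrite -(scale0V (0 : 'M[V]_n)) (os_scale NV) // Normc.normc0 mul0r.
Qed.

Let p (x : V) : R := N (const_mx x : 'M[V]_1).

Let pD x y : p (x + y) <= p x + p y.
Proof. by rewrite /p (raddfD (@const_mx V 1 1)) (os_triangle NV). Qed.

Let pZ c x : p (c *: x) = normc c * p x.
Proof.
rewrite /p -(os_scale NV) //; congr N.
by apply/matrixP => i j; rewrite !mxE.
Qed.

Let p_ge0 x : 0 <= p x. Proof. exact: (os_ge0 NV). Qed.

(** Functionals are completely bounded with the same constant: y^* [f (v_ij)] x = f (y^* v x), and
    y^* v x is a compression of v to size 1, of norm at most |y| |v| |x|. *)
Lemma opnorm_functional (f : V -> C^o) K n (v : 'M[V]_n) : linear f -> 0 <= K ->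
  (forall x, normc (f x) <= K * N (const_mx x : 'M[V]_1)) -> (0 < n)%N ->
  opnorm (\matrix_(i, j) f (v i j) : 'M[C]_n) <= K * N v.
Proof.
move=> fL K0 fK n0; have Nv0 := os_ge0 NV v n0.
have f0 : f 0 = 0 by have := fL (-1) 0 0; rewrite !scaleN1r addNr => ->; rewrite addNr.
have fsum (J : finType) (c : J -> C) (x : J -> V) :
    f (\sum_j c j *: x j) = \sum_j c j * f (x j).
  by elim/big_rec2: _ => [//|j y z _ <-]; rewrite fL.
apply: opnorm_le => [|x]; first by rewrite mulr_ge0.
apply: l2norm_le => [|y]; first by rewrite !mulr_ge0 ?l2norm_ge0.
set w : 'M[V]_1 := y^t* *ml v *mr x.
have -> : (y^t* *m ((\matrix_(i, j) f (v i j) : 'M[C]_n) *m x)) 0 0 = f (w 0 0).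
  rewrite mulmxA /w !mxE fsum; apply: eq_bigr => j _; rewrite !mxE fsum mulrC.
  by congr (_ * _); apply: eq_bigr => i _; rewrite !mxE.
apply: le_trans (fK _) _; rewrite -!mulrA ler_wpM2l //.
have -> : const_mx (w 0 0) = w by apply/matrixP => i j; rewrite mxE !ord1.
apply: le_trans (os_compress NV _ _ _ n0 _) _ => //.
rewrite opnorm_adj [leLHS]mulrAC [leLHS]mulrC ler_wpM2l //.
by rewrite [leRHS]mulrC ler_pM ?opnorm_ge0 // opnorm_colV.
Qed.

(** Induction on n: the residual map r of the first n terms kills the earlier vectors, so adding the
    term (psi o r) (x) r (v n), with psi equal to 1 on r (v n), fixes the new vector without
    disturbing them. Indexing by [nat] lets the new term be put at position n. *)
Lemma bounded_finite_rank_fix (v : nat -> V) n :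
  exists (f : nat -> V -> C^o) (e : nat -> V) (K : R),
  [/\ forall j, linear (f j), 0 <= K,
      forall j x, normc (f j x) <= K * N (const_mx x : 'M[V]_1) &
      forall i, (i < n)%N -> v i = \sum_(j < n) f j (v i) *: e j].
Proof.
elim: n => [|n [f [e [K [fL K0 fK fv]]]]].
  exists (fun _ _ => 0), (fun _ => 0), 0; split=> // [j c x y|j x].
    by rewrite scaler0 addr0.
  by rewrite Normc.normc0 mul0r.
pose r x := x - \sum_(j < n) f j x *: e j.
have rL : linear r.
  move=> c x y; rewrite /r scalerBr addrACA -opprD; congr (_ - _).
  rewrite scaler_sumr -big_split; apply: eq_bigr => j _ /=.
  by rewrite fL scalerDl scalerA.
(* The condition on psi is stated so that psi = 0 covers a vanishing residual. *)
have [psi [L [psiL psi_w L0 psiK]]] : exists (psi : V -> C^o) (L : R),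
    [/\ linear psi, psi (r (v n)) *: r (v n) = r (v n), 0 <= L &
        forall x, normc (psi x) <= L * p x].
  have [w0|w0] := eqVneq (r (v n)) 0.
    exists (fun _ => 0), 0; split=> [c x y|||x]; last by rewrite Normc.normc0 mul0r.
    - by rewrite scaler0 addr0.
    - by rewrite w0 scaler0.
    - exact: lexx.
  have pw : 0 < p (r (v n)).
    rewrite lt0r p_ge0 andbT; apply: contra w0 => /eqP/(os_eq0 NV) => /(_ isT).
    by move=> /matrixP/(_ 0 0); rewrite !mxE => ->.
  have [psi [L [psiL psi1 L0 psiK]]] := separating_functional pD pZ pw.
  by exists psi, L; rewrite psi1 scale1r.
pose S := \sum_(j < n) K * p (e j).
have S0 : 0 <= S by apply: sumr_ge0 => j _; rewrite mulr_ge0.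
have rK x : p (r x) <= (1 + S) * p x.
  rewrite /r (le_trans (pD _ _)) // mulrDl mul1r lerD //.
  rewrite -scaleN1r pZ normcN Normc.normc1 mul1r /S mulr_suml.
  elim/big_ind2: _ => [|x1 x2 y1 y2 h1 h2|j _].
  - by rewrite -(scale0r 0) pZ Normc.normc0 mul0r.
  - by rewrite (le_trans (pD _ _)) // lerD.
  - by rewrite pZ mulrAC ler_wpM2r.
(* K' dominates both the old constant K and the bound L (1 + S) of psi o r. *)
pose K' := K + L * (1 + S).
have LS0 : 0 <= L * (1 + S) by rewrite mulr_ge0 ?addr_ge0.
exists (fun j x => if j == n then psi (r x) else f j x),
  (fun j => if j == n then r (v n) else e j), K'; split.
- move=> j c x y; case: eqP => _; last exact: fL.
  by rewrite rL psiL.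
- by rewrite addr_ge0.
- move=> j x; case: eqP => _.
    apply: le_trans (psiK _) _; apply: le_trans (ler_wpM2l L0 (rK x)) _.
    by rewrite mulrA ler_wpM2r ?p_ge0 // lerDr.
  by apply: le_trans (fK _ _) _; rewrite ler_wpM2r ?p_ge0 // lerDl.
- move=> i; rewrite ltnS big_ord_recr /= eqxx => le_in.
  rewrite (eq_bigr (fun j : 'I_n => f j (v i) *: e j)) => [|j _]; last first.
    by rewrite ltn_eqF.
  move: le_in; rewrite leq_eqVlt => /predU1P[->|lt_in].
    by rewrite psi_w /r addrC subrK.
  have r0 : r (v i) = 0 by rewrite /r -fv // subrr.
  have psi0 : psi 0 = 0.
    by have := psiL (-1) 0 0; rewrite !scaleN1r addNr => ->; rewrite addNr.
  by rewrite r0 psi0 scale0r addr0 -fv.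
Qed.

End OperatorSpaceTheory.

(** * The tensor of matrices over lambda *)

Section TensLamTheory.
Variables (R : realType) (m : nat) (tau : nat -> nat).
Local Notation C := R[i].
Local Notation normc := Normc.normc.
Variable lam : forall k, ('I_m -> 'M[C]_k) -> 'M[C]_(tau k).
Variable V : 'I_m -> lmodType C.

(** The definition of [tens_lam] expands on the matrix units of M_k; this allows any finite family
    of elementary tensors, in particular positions of a direct sum whose units vanish on one
    summand. *)
Lemma tens_lam_sum k (J : finType) (a : 'I_m -> J -> 'M[C]_k)
    (x : forall t, J -> V t) : (0 < k)%N -> (0 < #|J|)%N ->
  multilinear (U := fun=> 'M[C]_k) (@lam k) ->
  tens_lam lam (fun t => \sum_j elemV (a t j) (x t j)) =
  \sum_(g : {ffun 'I_m -> J})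
    elemV (lam (fun t => a t (g t))) (tpure (fun t => x t (g t))).
Proof.
move=> k0 J0 lamM; apply/matrixP => i j; rewrite summxE mxE.
under eq_bigr => f _.
  have -> : (fun t => (\sum_j elemV (a t j) (x t j)) (f t).1 (f t).2) =
      (fun t => \sum_j a t j (f t).1 (f t).2 *: x t j).
    apply/functional_extensionality_dep => t; rewrite summxE.
    by apply: eq_bigr => l _; rewrite mxE.
  rewrite (multilinear_sum (@tpure_multilinear R m V)) // scaler_sumr.
  over.
rewrite exchange_big; apply: eq_bigr => g _ /=; rewrite mxE.
have aE : (fun t => a t (g t)) =
    fun t => \sum_(q : 'I_k * 'I_k) a t (g t) q.1 q.2 *: delta_mx q.1 q.2.
  by apply/funext => t; rewrite {1}[a t (g t)]matrix_sum_delta pair_bigA.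
rewrite [in RHS]aE (multilinear_sum lamM); last by rewrite card_prod !card_ord muln_gt0 k0.
rewrite summxE scaler_suml; apply: eq_bigr => f _.
by rewrite mxE scalerA mulrC.
Qed.

Lemma tens_lam_scale k (c : 'I_m -> C) (v : forall t, 'M[V t]_k) :
  tens_lam lam (fun t => scaleV (c t) (v t)) = scaleV (\prod_t c t) (tens_lam lam v).
Proof.
apply/matrixP => i j; rewrite !mxE scaler_sumr; apply: eq_bigr => f _.
have -> : (fun t => scaleV (c t) (v t) (f t).1 (f t).2) =
    (fun t => c t *: v t (f t).1 (f t).2).
  by apply/functional_extensionality_dep => t; rewrite mxE.
rewrite (multilinear_scale (@tpure_multilinear R m V)).
by rewrite !scalerA mulrC.
Qed.

(** Multilinearity: v is unchanged when rescaled by 0 at t and by 1 elsewhere, and the product of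
    these scalars is 0. *)
Lemma tens_lam_eq0 k (v : forall t, 'M[V t]_k) t : v t = 0 -> tens_lam lam v = 0.
Proof.
move=> v0; pose c s : C := (s != t)%:R.
have -> : v = fun s => scaleV (c s) (v s).
  apply/functional_extensionality_dep => s; rewrite /c.
  by have [->|_] := eqVneq s t; rewrite ?scale1V // v0 scale0V.
rewrite tens_lam_scale (bigD1 t) //= /c eqxx mul0r.
exact: scale0V.
Qed.

Lemma elemV_diag_block (W : lmodType C) p q n k (a : 'M[C]_(p, q)) (b : 'M[C]_(n, k))
    (x : W) : elemV (block_mx a 0 0 b) x = block_mx (elemV a x) 0 0 (elemV b x).
Proof.
have E r s (c : 'M[C]_(r, s)) : elemV c x = map_mx (fun z => z *: x) c.
  by apply/matrixP => i j; rewrite !mxE.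
by rewrite !E map_block_mx; congr block_mx; apply/matrixP => i j; rewrite !mxE scale0r.
Qed.

Lemma sum_diag_block (W : zmodType) (J : finType) p q n k
    (v : J -> 'M[W]_(p, q)) (w : J -> 'M[W]_(n, k)) :
  \sum_j block_mx (v j) 0 0 (w j) = block_mx (\sum_j v j) 0 0 (\sum_j w j).
Proof.
elim/big_rec3: _ => [|j y1 y2 y3 _ ->]; last by rewrite add_block_mx !addr0.
by apply/matrixP => a b; rewrite -(splitK a) -(splitK b); case: (fintype.split a) => a';
  case: (fintype.split b) => b' /=;
  rewrite ?(block_mxEul, block_mxEur, block_mxEdl, block_mxEdr) !mxE.
Qed.

(* E2 describes lambda on tuples of block diagonal matrix units; expanding v_t    *)
(* and w_t over the same index set J of positions makes both sides sums over   *)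
(* the functions from 'I_m to J. *)
Lemma tens_lam_block r s (P : 'M[C]_(tau r + tau s, tau (r + s)))
    (v : forall t, 'M[V t]_r) (w : forall t, 'M[V t]_s) :
  lambda_multilinear lam -> (0 < r)%N -> (0 < s)%N -> condE2_eq lam P ->
  P *ml tens_lam lam (fun t => block_mx (v t) 0 0 (w t)) *mr P^t* =
  block_mx (tens_lam lam v) 0 0 (tens_lam lam w).
Proof.
move=> lamM r0 s0 PE.
pose J : finType := (('I_r * 'I_r) + ('I_s * 'I_s))%type.
have J0 : (0 < #|J|)%N.
  by rewrite card_sum !card_prod !card_ord addn_gt0 !muln_gt0 r0.
pose x t (j : J) : V t :=
  match j with inl q => v t q.1 q.2 | inr q => w t q.1 q.2 end.
pose row (j : J) : nat := match j with inl q => q.1.+1 | inr q => (r + q.1).+1 end.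
pose col (j : J) : nat := match j with inl q => q.2.+1 | inr q => (r + q.2).+1 end.
have vE : v = fun t => \sum_j elemV (eps R r (row j) (col j)) (x t j).
  apply/functional_extensionality_dep => t; rewrite big_sumType /=.
  rewrite [X in _ + X]big1 ?addr0 => [|q _]; last first.
    apply/matrixP => i j; rewrite !mxE eqSS ltn_eqF ?scale0r //.
    exact: leq_trans (ltn_ord i) (leq_addr _ _).
  rewrite {1}[v t]matrix_sum_elemV; apply: eq_bigr => q _; congr elemV.
  by apply/matrixP => i j; rewrite !mxE !eqSS.
have wE : w = fun t => \sum_j elemV (eps R s (row j - r) (col j - r)) (x t j).
  apply/functional_extensionality_dep => t; rewrite big_sumType /=.
  rewrite [X in X + _]big1 ?add0r => [|q _]; last first.
    apply/matrixP => i j; rewrite !mxE.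
    (* A row of the first block truncates to 0, out of range for positions numbered from 1, so its
       unit in M_s vanishes. *)
    have -> : (q.1.+1 - r = 0)%N by apply/eqP; rewrite subn_eq0.
    by rewrite scale0r.
  rewrite {1}[w t]matrix_sum_elemV; apply: eq_bigr => q _; congr elemV.
  by apply/matrixP => i j; rewrite !mxE -!addnS ![(r + _)%N]addnC !addnK !eqSS.
have in_block j : ((1 <= row j <= r) && (1 <= col j <= r) ||
    (r + 1 <= row j <= r + s) && (r + 1 <= col j <= r + s))%N.
  by case: j => -[[a a_lt] [b b_lt]]; rewrite /row /col /=; lia.
(* At each position exactly one of the two diagonal units is nonzero, so one formula serves both
   blocks. *)
have epsE j : eps R (r + s) (row j) (col j) =
    block_mx (eps R r (row j) (col j)) 0 0 (eps R s (row j - r) (col j - r)).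
  move: (row j) (col j) (in_block j) => a b ab.
  apply/matrixP => i l; rewrite -(splitK i) -(splitK l).
  case: (fintype.split i) => -[i' i_lt]; case: (fintype.split l) => -[l' l_lt] /=;
    rewrite ?(block_mxEul, block_mxEur, block_mxEdl, block_mxEdr) !mxE /=;
    first [ by congr (nat_of_bool _)%:R; apply/idP/idP; lia
          | by rewrite (_ : _ && _ = false) //; apply/negP; lia ].
have vwE : (fun t => block_mx (v t) 0 0 (w t)) =
    fun t => \sum_j elemV (eps R (r + s) (row j) (col j)) (x t j).
  apply/functional_extensionality_dep => t; rewrite {1}vE {1}wE -sum_diag_block.
  by apply: eq_bigr => j _; rewrite epsE elemV_diag_block.
have rs0 : (0 < r + s)%N by rewrite addn_gt0 r0.
have [lamr lams lamrs] := And3 (lamM r r0) (lamM s s0) (lamM _ rs0).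
rewrite vwE {1}vE {1}wE !tens_lam_sum //.
rewrite lmulV_sum rmulV_sum -sum_diag_block; apply: eq_bigr => g _.
rewrite lmul_elemV rmul_elemV PE => [|t]; last exact: in_block.
exact: elemV_diag_block.
Qed.

End TensLamTheory.

(** * The lambda-norm *)

(** This passes to the infimum: an estimate proved for every c above the norm holds for the norm. K
    may be 0, hence the division by K + 1. *)
Lemma le_mul_gt (R : realFieldType) (K x y : R) : 0 <= K ->
  (forall c, x < c -> y <= K * c) -> y <= K * x.
Proof.
move=> K0 h; apply/ler_addgt0Pr => e e0.
have K1 : 0 < K + 1 by lra.
apply: le_trans (h (x + e / (K + 1)) _) _; first by rewrite ltrDl divr_gt0.
rewrite mulrDr lerD2l mulrA ler_pdivrMr // mulrDr mulr1 mulrC lerDl.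
exact: ltW.
Qed.

Section LambdaNorm.
Variables (R : realType) (m : nat) (tau : nat -> nat).
Local Notation C := R[i].
Local Notation normc := Normc.normc.
Variable lam : forall k, ('I_m -> 'M[C]_k) -> 'M[C]_(tau k).
Hypothesis lam_std : standing_conditions lam.

(** Normalise each argument and pull out the scalars. Since 0 has inverse 0, an argument of norm 0
    is normalised to 0, which is harmless because it is itself 0. *)
Lemma opnorm_lam k (x : 'I_m -> 'M[C]_k) : (0 < k)%N ->
  opnorm (lam x) <= \prod_t opnorm (x t).
Proof.
move=> k0; have lamM := lambda_multilinearity lam_std k0.
have := lambda_N2 lam_std k0; rewrite /mlnorm; set S := [set _ | _ in _] => supS.
(* A set without supremum has [sup] equal to 0, so the value 1 in (N2) also shows that S is
   bounded. *)
have S_sup : has_sup S.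
  by apply: contrapT => /sup_out; rewrite supS => /eqP; rewrite oner_eq0.
pose y t := ((opnorm (x t))^-1)%:C%C *: x t.
have xE : x = fun t => (opnorm (x t))%:C%C *: y t.
  apply/funext => t; rewrite scalerA -rmorphM /=.
  have [x0|x0] := eqVneq (opnorm (x t)) 0; last by rewrite mulfV // scale1r.
  apply/matrixP => i j; rewrite mxE; suff -> : x t i j = 0 by rewrite mulr0.
  by apply: Normc.eq0_normc; apply/le_anti; rewrite normc_ge0 -x0 normc_le_opnorm.
rewrite {1}xE (multilinear_scale lamM) (le_trans (opnormZ _ _)) //.
rewrite normc_prod (eq_bigr (fun t => opnorm (x t))) => [|t _]; last first.
  by rewrite normc_real ger0_norm ?opnorm_ge0.
rewrite -[leRHS]mulr1 ler_wpM2l ?prodr_ge0 // => [t _|]; first exact: opnorm_ge0.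
rewrite -supS; apply: (ub_le_sup S_sup.2); exists y => // t /=.
apply: le_trans (opnormZ _ _) _; rewrite normc_real ger0_norm ?invr_ge0 ?opnorm_ge0 //.
by have [->|x0] := eqVneq (opnorm (x t)) 0; rewrite ?mulr0 ?ler01 // mulVf.
Qed.

Variable V : 'I_m -> lmodType C.
Variable D : forall t, mo_structure (V t).
Hypothesis V_os : forall t, operator_space (mnorm (D t)).

Lemma tens_lam_direct_sum r s (v : forall t, 'M[V t]_r) (w : forall t, 'M[V t]_s) :
  (0 < r)%N -> (0 < s)%N ->
  exists2 P : 'M[C]_(tau r + tau s, tau (r + s)), opnorm P <= 1 &
    block_mx (tens_lam lam v) 0 0 (tens_lam lam w) =
    P *ml tens_lam lam (fun t => block_mx (v t) 0 0 (w t)) *mr P^t*.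
Proof.
move=> r0 s0; have [P P1 PE] := lambda_E2 lam_std r0 s0.
by exists P => //; rewrite (tens_lam_block _ _ (lambda_multilinearity lam_std)).
Qed.

(** The infimum is thus over a nonempty set. Elementary tensors are represented in size 1, where
    lambda_1 (1, ..., 1) = 1 by (E3), and (E2) merges the representations of a sum. *)
Lemma lambda_rep_exists n (u : 'M[tensor V]_n) :
  exists j (a : 'M[C]_(n, tau j)) (v : forall t, 'M[V t]_j) (b : 'M[C]_(tau j, n)),
    (0 < j)%N /\ u = a *ml tens_lam lam v *mr b.
Proof.
pose rep (u : 'M[tensor V]_n) := exists j (a : 'M[C]_(n, tau j))
  (v : forall t, 'M[V t]_j) (b : 'M[C]_(tau j, n)),
    (0 < j)%N /\ u = a *ml tens_lam lam v *mr b.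
have rep0 : rep 0.
  by exists 1%N, 0, (fun=> 0), 0; rewrite lmul0V rmul0V.
have repD w1 w2 : rep w1 -> rep w2 -> rep (w1 + w2).
  move=> [r [a1 [v1 [b1 [r0 ->]]]]] [s [a2 [v2 [b2 [s0 ->]]]]].
  have [P _ PE] := tens_lam_direct_sum v1 v2 r0 s0.
  exists (r + s)%N, (row_mx a1 a2 *m P), (fun t => block_mx (v1 t) 0 0 (v2 t)),
    (P^t* *m col_mx b1 b2); rewrite addn_gt0 r0; split=> //.
  by rewrite -row_block_col PE mulV_sandwich.
suff repE i j x : rep (elemV (delta_mx i j) x).
  by rewrite [u]matrix_sum_elemV; apply: (big_ind rep) => // q _; exact: repE.
elim/tensor_ind: x => [|c v x ih].
  suff -> : elemV (delta_mx i j) (0 : tensor V) = 0 by exact: rep0.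
  by apply/matrixP => k l; rewrite !mxE scaler0.
have -> : elemV (delta_mx i j) (c *: tpure v + x) =
    elemV (c *: delta_mx i j) (tpure v) + elemV (delta_mx i j) x.
  by apply/matrixP => k l; rewrite !mxE scalerDr scalerA mulrC.
apply: repD => //.
pose z : 'I_(tau 1) := Ordinal (lambda_size_gt0 lam_std (ltn0Sn 0)).
exists 1%N, (c *: delta_mx i z), (fun t => elemV 1%:M (v t)), (delta_mx z j).
rewrite tens_lamE //; last exact: (lambda_multilinearity lam_std).
split=> //; rewrite (lambda_E3 lam_std).1 lmul_elemV rmul_elemV mulmx1.
by rewrite -scalemxAl mul_delta_mx.
Qed.

(** A balanced representation: the tensor factors are contractions and the bound c is shared equally
    by the two outer factors. It implies that the norm is at most c, and exists as soon as the norm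
    is below c. *)
Definition lambda_rep_le n (u : 'M[tensor V]_n) (c : R) :=
  exists j (a : 'M[C]_(n, tau j)) (v : forall t, 'M[V t]_j) (b : 'M[C]_(tau j, n)),
    [/\ (0 < j)%N, u = a *ml tens_lam lam v *mr b,
        forall t, mnorm (D t) (v t) <= 1,
        opnorm a <= Num.sqrt c & opnorm b <= Num.sqrt c].

Lemma lambda_norm_le n j (a : 'M[C]_(n, tau j)) (v : forall t, 'M[V t]_j)
    (b : 'M[C]_(tau j, n)) : (0 < j)%N ->
  lambda_norm lam D (a *ml tens_lam lam v *mr b) <=
  opnorm a * (\prod_(t < m) mnorm (D t) (v t)) * opnorm b.
Proof.
move=> j0; apply: ge_inf; last by exists j, a, v, b.
exists 0 => _ [k [a' [v' [b' [k0 _ ->]]]]].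
rewrite !mulr_ge0 ?opnorm_ge0 // prodr_ge0 // => t _.
exact: (os_ge0 (V_os t)).
Qed.

Lemma lambda_norm_le_unit n j (a : 'M[C]_(n, tau j)) (v : forall t, 'M[V t]_j)
    (b : 'M[C]_(tau j, n)) : (0 < j)%N -> (forall t, mnorm (D t) (v t) <= 1) ->
  lambda_norm lam D (a *ml tens_lam lam v *mr b) <= opnorm a * opnorm b.
Proof.
move=> j0 v1; apply: le_trans (lambda_norm_le a v b j0) _.
rewrite ler_wpM2r ?opnorm_ge0 // -[leRHS]mulr1 ler_wpM2l ?opnorm_ge0 //.
by rewrite Num.Theory.prodr_ile1 // => t _; rewrite v1 (os_ge0 (V_os t)).
Qed.

Lemma lambda_norm_ge0 n (u : 'M[tensor V]_n) : 0 <= lambda_norm lam D u.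
Proof.
apply: lb_le_inf => [|_ [k [a' [v' [b' [k0 _ ->]]]]]].
  have [j [a [v [b [j0 uE]]]]] := lambda_rep_exists u.
  by eexists; exists j, a, v, b.
rewrite !mulr_ge0 ?opnorm_ge0 // prodr_ge0 // => t _.
exact: (os_ge0 (V_os t)).
Qed.

Lemma lambda_rep_le_norm n (u : 'M[tensor V]_n) c :
  0 <= c -> lambda_rep_le u c -> lambda_norm lam D u <= c.
Proof.
move=> c0 [j [a [v [b [j0 -> v1 ac bc]]]]].
apply: le_trans (lambda_norm_le_unit _ _ j0 v1) _.
rewrite -[leRHS]sqr_sqrtr // expr2.
by rewrite ler_pM ?opnorm_ge0.
Qed.

(** For u nonzero, neither a nor any v_t can vanish in a representation, so their norms can be
    divided out and moved to b. *)
Lemma lambda_norm_lt_rep n (u : 'M[tensor V]_n) c :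
  lambda_norm lam D u < c -> lambda_rep_le u c.
Proof.
move=> uc; have c0 : 0 < c := le_lt_trans (lambda_norm_ge0 u) uc.
have [->|u0] := eqVneq u 0.
  exists 1%N, 0, (fun=> 0), 0; split=> //; rewrite ?opnorm0 ?sqrtr_ge0 //.
    by rewrite lmul0V rmul0V.
  by move=> t; rewrite (os_norm0 (V_os t)) // ler01.
have := uc; rewrite /lambda_norm; set S := (X in inf X) => infS.
have [_ [j [a [v [b [j0 uE ->]]]]] ltc] : exists2 x, S x & x < c.
  apply: inf_lt infS; have [j [a [v [b [j0 uE]]]]] := lambda_rep_exists u.
  by eexists; exists j, a, v, b.
have N0 t : 0 < mnorm (D t) (v t).
  rewrite lt0r (os_ge0 (V_os t)) // andbT; apply: contra_neq u0 => vt0.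
  rewrite uE (tens_lam_eq0 lam (os_eq0 (V_os t) j0 vt0)).
  by rewrite lmulV0 rmul0V.
have a0 : 0 < opnorm a.
  rewrite lt0r opnorm_ge0 andbT; apply: contra_neq u0 => a0.
  suff a00 : a = 0 by rewrite uE a00 lmul0V rmul0V.
  apply/matrixP => k l; rewrite mxE; apply: Normc.eq0_normc; apply/le_anti.
  by rewrite normc_ge0 -a0 normc_le_opnorm.
set P := \prod_t _ in ltc.
have P0 : 0 < P by apply: prodr_gt0.
have sc0 : 0 < Num.sqrt c by rewrite sqrtr_gt0.
(* Scaling a by s brings its bound to sqrt c; b is scaled by P / s, and its norm is then at most |a|
   P |b| / sqrt c <= sqrt c. *)
pose s := Num.sqrt c / opnorm a.
have s0 : 0 < s by rewrite divr_gt0.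
exists j, (s%:C%C *: a), (fun t => scaleV ((mnorm (D t) (v t))^-1)%:C%C (v t)),
  ((P / s)%:C%C *: b); split=> //.
- rewrite tens_lam_scale -(rmorph_prod (real_complex R)) /=.
  rewrite lmulV_scale scale_rmulV lscale_mulV scale_rmulV rscale_mulV !scaleVA.
  rewrite -!rmorphM /= prodfV -/P.
  have -> : P^-1 * s * (P / s) = 1 by field; rewrite !gt_eqF.
  by rewrite scale1V.
- move=> t; rewrite (os_scale (V_os t)) // normc_real ger0_norm ?invr_ge0 ?(ltW (N0 t)) //.
  by rewrite mulVf // gt_eqF.
- rewrite (le_trans (opnormZ _ _)) // normc_real gtr0_norm // /s divfK //.
  by rewrite gt_eqF.
- rewrite (le_trans (opnormZ _ _)) // normc_real gtr0_norm ?divr_gt0 //.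
  have -> : P / s * opnorm b = (opnorm a * P * opnorm b) / Num.sqrt c.
    by rewrite /s; field; rewrite !gt_eqF.
  by rewrite ler_pdivrMr // -expr2 sqr_sqrtr ?ltW.
Qed.

Lemma block_unit_norm r s (v : forall t, 'M[V t]_r) (w : forall t, 'M[V t]_s) :
  (0 < r)%N -> (0 < s)%N -> (forall t, mnorm (D t) (v t) <= 1) ->
  (forall t, mnorm (D t) (w t) <= 1) ->
  forall t, mnorm (D t) (block_mx (v t) 0 0 (w t)) <= 1.
Proof.
by move=> r0 s0 v1 w1 t; rewrite (os_sum (V_os t)) // ge_max v1 w1.
Qed.

Lemma opnorm_mulmx_contr k l n (a : 'M[C]_(k, l)) (P : 'M[C]_(l, n)) c :
  opnorm P <= 1 -> opnorm a <= c -> opnorm (a *m P) <= c.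
Proof.
move=> P1 ac; apply: le_trans (opnormM _ _) _.
by rewrite -[leRHS]mulr1 ler_pM ?opnorm_ge0.
Qed.

Lemma opnorm_contr_mulmx k l n (P : 'M[C]_(k, l)) (b : 'M[C]_(l, n)) c :
  opnorm P <= 1 -> opnorm b <= c -> opnorm (P *m b) <= c.
Proof.
move=> P1 bc; apply: le_trans (opnormM _ _) _.
by rewrite -[leRHS]mul1r ler_pM ?opnorm_ge0.
Qed.

(** The direct sums of the v_t stay contractive by Ruan's axiom, while the row and the column of
    outer factors have norm at most sqrt (c + d); the contraction P of (E2) is absorbed into
    them. *)
Lemma lambda_rep_leD n (u w : 'M[tensor V]_n) c d : 0 <= c -> 0 <= d ->
  lambda_rep_le u c -> lambda_rep_le w d -> lambda_rep_le (u + w) (c + d).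
Proof.
move=> c0 d0 [r [a1 [v1 [b1 [r0 -> v1_le a1c b1c]]]]].
move=> [s [a2 [v2 [b2 [s0 -> v2_le a2d b2d]]]]].
have [P P1 PE] := tens_lam_direct_sum v1 v2 r0 s0.
exists (r + s)%N, (row_mx a1 a2 *m P), (fun t => block_mx (v1 t) 0 0 (v2 t)),
  (P^t* *m col_mx b1 b2); split.
- by rewrite addn_gt0 r0.
- by rewrite -row_block_col PE mulV_sandwich.
- exact: block_unit_norm.
- apply: opnorm_mulmx_contr => //; apply: le_trans (opnorm_row_mx _ _) _.
  apply: ler_wsqrtr; rewrite -(sqr_sqrtr c0) -(sqr_sqrtr d0).
  by rewrite lerD // ler_pXn2r ?nnegrE ?opnorm_ge0 ?sqrtr_ge0.
- apply: opnorm_contr_mulmx; rewrite ?opnorm_adj //.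
  apply: le_trans (opnorm_col_mx _ _) _.
  apply: ler_wsqrtr; rewrite -(sqr_sqrtr c0) -(sqr_sqrtr d0).
  by rewrite lerD // ler_pXn2r ?nnegrE ?opnorm_ge0 ?sqrtr_ge0.
Qed.

Lemma lambda_rep_le_block n p (u : 'M[tensor V]_n) (w : 'M[tensor V]_p) c :
  lambda_rep_le u c -> lambda_rep_le w c -> lambda_rep_le (block_mx u 0 0 w) c.
Proof.
move=> [r [a1 [v1 [b1 [r0 -> v1_le a1c b1c]]]]].
move=> [s [a2 [v2 [b2 [s0 -> v2_le a2c b2c]]]]].
have [P P1 PE] := tens_lam_direct_sum v1 v2 r0 s0.
exists (r + s)%N, (block_mx a1 0 0 a2 *m P), (fun t => block_mx (v1 t) 0 0 (v2 t)),
  (P^t* *m block_mx b1 0 0 b2); split.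
- by rewrite addn_gt0 r0.
- by rewrite -block_block_block PE mulV_sandwich.
- exact: block_unit_norm.
- apply: opnorm_mulmx_contr => //; apply: le_trans (opnorm_diag_block _ _) _.
  by rewrite ge_max a1c.
- apply: opnorm_contr_mulmx; rewrite ?opnorm_adj //.
  by apply: le_trans (opnorm_diag_block _ _) _; rewrite ge_max b1c.
Qed.

Lemma lambda_norm_compress n k (a : 'M[C]_(k, n)) (u : 'M[tensor V]_n)
    (b : 'M[C]_(n, k)) :
  lambda_norm lam D (a *ml u *mr b) <= opnorm a * lambda_norm lam D u * opnorm b.
Proof.
rewrite mulrAC; apply: le_mul_gt; first by rewrite mulr_ge0 ?opnorm_ge0.
move=> c uc; have c0 : 0 <= c := le_trans (lambda_norm_ge0 u) (ltW uc).
have [j [a' [v [b' [j0 -> v1 ac bc]]]]] := lambda_norm_lt_rep uc.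
rewrite mulV_sandwich (le_trans (lambda_norm_le_unit _ _ j0 v1)) //.
rewrite -[X in _ <= _ * X](sqr_sqrtr c0) expr2 mulrACA.
apply: ler_pM; rewrite ?opnorm_ge0 //.
  by rewrite (le_trans (opnormM _ _)) // ler_wpM2l ?opnorm_ge0.
by rewrite (le_trans (opnormM _ _)) // mulrC ler_wpM2l ?opnorm_ge0.
Qed.

Lemma lambda_normD n (u w : 'M[tensor V]_n) :
  lambda_norm lam D (u + w) <= lambda_norm lam D u + lambda_norm lam D w.
Proof.
apply/ler_addgt0Pr => e e0; have e2 : 0 < e / 2 by rewrite divr_gt0.
have u0 := lambda_norm_ge0 u; have w0 := lambda_norm_ge0 w.
have c0 : 0 <= lambda_norm lam D u + e / 2 by lra.
have d0 : 0 <= lambda_norm lam D w + e / 2 by lra.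
have -> : lambda_norm lam D u + lambda_norm lam D w + e =
  (lambda_norm lam D u + e / 2) + (lambda_norm lam D w + e / 2) by field.
apply: lambda_rep_le_norm; first exact: addr_ge0.
by apply: lambda_rep_leD => //; apply: lambda_norm_lt_rep; rewrite ltrDl.
Qed.

(** Scaling is compression by a multiple of the identity, which gives one inequality; for c nonzero
    the other is the same inequality for c^-1. *)
Lemma lambda_norm_scale n c (u : 'M[tensor V]_n) :
  lambda_norm lam D (scaleV c u) = normc c * lambda_norm lam D u.
Proof.
have le d (w : 'M[tensor V]_n) : lambda_norm lam D (scaleV d w) <= normc d * lambda_norm lam D w.
  have -> : scaleV d w = (d *: 1%:M) *ml w *mr 1%:M :> 'M[tensor V]_n.
    by rewrite lscale_mulV lmul1V rmulV1.
  apply: le_trans (lambda_norm_compress _ _ _) _; rewrite -[leRHS]mulr1.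
  have N0 := lambda_norm_ge0 w.
  apply: ler_pM; rewrite ?mulr_ge0 ?opnorm_ge0 ?opnorm1 //.
  rewrite ler_wpM2r // (le_trans (opnormZ _ _)) // -[leRHS]mulr1.
  by rewrite ler_wpM2l ?normc_ge0 ?opnorm1.
apply/le_anti; rewrite le /=.
have [->|c0] := eqVneq c 0; first by rewrite Normc.normc0 mul0r lambda_norm_ge0.
have cn0 : 0 < normc c.
  by rewrite lt0r normc_ge0 andbT; apply: contra_neq c0; exact: Normc.eq0_normc.
have := le c^-1 (scaleV c u); rewrite scaleVA mulVf // scale1V Normc.normcV.
by rewrite ler_pdivlMl.
Qed.

(** Upper bound: balanced representations of u and w with a common c fit side by side. Lower bound:
    each corner is a contractive compression of the block. *)
Lemma lambda_norm_block n p (u : 'M[tensor V]_n) (w : 'M[tensor V]_p) :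
  lambda_norm lam D (block_mx u 0 0 w) =
  Num.max (lambda_norm lam D u) (lambda_norm lam D w).
Proof.
apply/le_anti/andP; split.
  rewrite -[leRHS]mul1r; apply: le_mul_gt => // c; rewrite gt_max mul1r => /andP[uc wc].
  apply: lambda_rep_le_norm; first exact: le_trans (lambda_norm_ge0 u) (ltW uc).
  by apply: lambda_rep_le_block; apply: lambda_norm_lt_rep.
have contr k l (a : 'M[C]_(k, l)) (z : 'M[tensor V]_l) : opnorm a <= 1 ->
    lambda_norm lam D (a *ml z *mr a^t*) <= lambda_norm lam D z.
  move=> a1; apply: le_trans (lambda_norm_compress _ _ _) _.
  have N0 := lambda_norm_ge0 z.
  rewrite opnorm_adj -[leRHS]mulr1 -[X in _ <= X * _]mul1r.
  by rewrite !ler_pM ?mulr_ge0 ?opnorm_ge0.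
have iso1 k l : opnorm (row_mx 1%:M 0 : 'M[C]_(k, k + l)) <= 1.
  rewrite (le_trans (opnorm_row_mx _ _)) // opnorm0 expr0n addr0 sqrtr_sqr.
  by rewrite ger0_norm ?opnorm_ge0 // opnorm1.
have iso2 k l : opnorm (row_mx 0 1%:M : 'M[C]_(k, l + k)) <= 1.
  rewrite (le_trans (opnorm_row_mx _ _)) // opnorm0 expr0n add0r sqrtr_sqr.
  by rewrite ger0_norm ?opnorm_ge0 // opnorm1.
have uE : row_mx 1%:M 0 *ml block_mx u 0 0 w *mr (row_mx 1%:M 0)^t* = u.
  by rewrite adj_row_mx row_block_col lmul0V rmul0V lmul1V addr0 trmx1 map_mx1 rmulV1.
have wE : row_mx 0 1%:M *ml block_mx u 0 0 w *mr (row_mx 0 1%:M)^t* = w.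
  by rewrite adj_row_mx row_block_col lmul0V rmul0V lmul1V add0r trmx1 map_mx1 rmulV1.
by rewrite ge_max; apply/andP; split; [rewrite -{1}uE | rewrite -{1}wE]; exact: contr.
Qed.

End LambdaNorm.

(** * Separation of tensors by products of bounded functionals *)

Section ProductFunctionals.
Variables (R : realType) (m : nat) (V : 'I_m -> lmodType R[i]).
Local Notation C := R[i].

Definition prod_functional (f : forall t, V t -> C^o) (v : forall t, V t) : C^o :=
  \prod_t f t (v t).

Lemma prod_functional_multilinear (f : forall t, V t -> C^o) :
  (forall t, linear (f t)) -> multilinear (prod_functional f).
Proof.
move=> fL u t c x y; rewrite /prod_functional.
have E z : \prod_s f s (dfwith u t z s) = f t z * \prod_(s | s != t) f s (u s).
  rewrite (bigD1 t) //= dfwithin; congr (_ * _); apply: eq_bigr => s st.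
  by rewrite dfwithout // eq_sym.
by rewrite !E fL mulrDl; congr (_ + _); rewrite -mulrA.
Qed.

Lemma tlift_sum (W : lmodType C) (f : (forall t, V t) -> W) (J : finType)
    (c : J -> C) (x : J -> tensor V) : multilinear f ->
  tlift f (\sum_j c j *: x j) = \sum_j c j *: tlift f (x j).
Proof.
move=> fM; elim/big_rec2: _ => [|j y z _ <-]; first exact: tlift_zero.
exact: tlift_linear.
Qed.

End ProductFunctionals.

Section LambdaOperatorSpace.
Variables (R : realType) (m : nat) (tau : nat -> nat).
Local Notation C := R[i].
Local Notation normc := Normc.normc.
Variable lam : forall k, ('I_m -> 'M[C]_k) -> 'M[C]_(tau k).
Hypothesis lam_std : standing_conditions lam.
Variable V : 'I_m -> lmodType C.
Variable D : forall t, mo_structure (V t).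
Hypothesis V_os : forall t, operator_space (mnorm (D t)).

(** This reduces a product functional on a representation to [lam] on scalar matrices, where (N2)
    applies. *)
Lemma tlift_tens_lam (f : forall t, V t -> C^o) n k p (a : 'M[C]_(n, tau k))
    (v : forall t, 'M[V t]_k) (b : 'M[C]_(tau k, p)) i j :
  (0 < k)%N -> (forall t, linear (f t)) ->
  tlift (prod_functional f) ((a *ml tens_lam lam v *mr b) i j) =
  (a *m lam (fun t => \matrix_(x, y) f t (v t x y)) *m b) i j.
Proof.
move=> k0 fL; have fM := prod_functional_multilinear fL.
have core x y : tlift (prod_functional f) (tens_lam lam v x y) =
    lam (fun t => \matrix_(x, y) f t (v t x y)) x y.
  rewrite mxE tlift_sum //.
  have aE : (fun t => \matrix_(x, y) f t (v t x y) : 'M[C]_k) =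
      fun t => \sum_(q : 'I_k * 'I_k) (f t (v t q.1 q.2) : C) *: delta_mx q.1 q.2.
    apply/funext => t; rewrite [LHS]matrix_sum_delta pair_bigA.
    by apply: eq_bigr => q _; rewrite mxE.
  rewrite aE (multilinear_sum (lambda_multilinearity lam_std k0)); last first.
    by rewrite card_prod !card_ord muln_gt0 k0.
  rewrite summxE; apply: eq_bigr => g _.
  by rewrite tlift_pure // mxE mulrC.
rewrite !mxE tlift_sum //; apply: eq_bigr => y _.
rewrite !mxE tlift_sum // [RHS]mulrC; congr (_ * _); apply: eq_bigr => x _.
by rewrite core.
Qed.

(** In a balanced representation the outer factors contribute c, (N2) bounds [lam] by the product of
    its arguments' norms, and each argument f_t (v_t) has norm at most K_t. *)
Lemma prod_functional_bound (f : forall t, V t -> C^o) (K : 'I_m -> R)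
    n (u : 'M[tensor V]_n) i j :
  (forall t, linear (f t)) -> (forall t, 0 <= K t) ->
  (forall t x, normc (f t x) <= K t * mnorm (D t) (const_mx x : 'M[V t]_1)) ->
  normc (tlift (prod_functional f) (u i j)) <= (\prod_t K t) * lambda_norm lam D u.
Proof.
move=> fL K0 fK; apply: le_mul_gt; first by apply: prodr_ge0.
move=> c uc; have c0 := le_trans (lambda_norm_ge0 lam_std V_os u) (ltW uc).
have [k [a [v [b [k0 -> v1 ac bc]]]]] := lambda_norm_lt_rep lam_std V_os uc.
rewrite tlift_tens_lam // (le_trans (normc_le_opnorm _ _ _)) //.
rewrite (le_trans (opnormM _ _)) // -(sqr_sqrtr c0) expr2 mulrA.
apply: ler_pM; rewrite ?opnorm_ge0 // (le_trans (opnormM _ _)) // mulrC.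
apply: ler_pM; rewrite ?opnorm_ge0 //.
apply: le_trans (opnorm_lam lam_std _ k0) _; apply: ler_prod => t _.
rewrite opnorm_ge0 /=; apply: le_trans (opnorm_functional (V_os t) _ (fL t) (K0 t) (fK t) k0) _.
by rewrite -[leRHS]mulr1 ler_wpM2l.
Qed.

(* Bounded finite rank maps fixing the finitely many vectors involved in x       *)
(* write x as a combination of pure tensors whose coefficients are values of    *)
(* products of bounded functionals at x. *)
Lemma tensor_eq0_functionals (x : tensor V) :
  (forall (f : forall t, V t -> C^o) (K : 'I_m -> R),
    (forall t, linear (f t)) -> (forall t, 0 <= K t) ->
    (forall t y, normc (f t y) <= K t * mnorm (D t) (const_mx y : 'M[V t]_1)) ->
    tlift (prod_functional f) x = 0) -> x = 0.
Proof.
move=> x0; have [s sE] := tensor_pureE x.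
(* The successor keeps 'I_n nonempty, as [multilinear_sum] requires; the extra vector is the default
   0. *)
pose n := (size s).+1.
pose v t k : V t := (nth (0, fun=> 0) s k).2 t.
pose T t := ((nat -> V t -> C^o) * (nat -> V t) * R)%type.
have H t : exists y : T t, [/\ forall j, linear (y.1.1 j), 0 <= y.2,
      forall j x, normc (y.1.1 j x) <= y.2 * mnorm (D t) (const_mx x : 'M[V t]_1) &
      forall i, (i < n)%N -> v t i = \sum_(j < n) y.1.1 j (v t i) *: y.1.2 j].
  have [f [e [K fP]]] := bounded_finite_rank_fix (V_os t) (v t) n.
  by exists (f, e, K).
pose y t : T t := projT1 (cid (H t)).
have yP t := projT2 (cid (H t)).
pose f t := (y t).1.1; pose e t := (y t).1.2; pose K t := (y t).2.
have fL t j : linear (f t j) by case: (yP t) => h _ _ _; exact: h.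
have K0 t : 0 <= K t by case: (yP t).
have fK t j z : normc (f t j z) <= K t * mnorm (D t) (const_mx z : 'M[V t]_1).
  by case: (yP t) => _ _ h _; exact: h.
have fv t i : (i < n)%N -> v t i = \sum_(j < n) f t j (v t i) *: e t j.
  by case: (yP t) => _ _ _; apply.
pose F (g : {ffun 'I_m -> 'I_n}) := prod_functional (fun t => f t (g t)).
have FM g : multilinear (F g) by apply: prod_functional_multilinear => t.
(* L is the tensor product of the finite rank maps; it fixes each pure tensor in s, hence x. *)
pose L z := \sum_g tlift (F g) z *: tpure (fun t => e t (g t)).
have LL : linear L.
  move=> c z z'; rewrite /L scaler_sumr -big_split; apply: eq_bigr => g _ /=.
  by rewrite tlift_linear // scalerDl scalerA.
have L0 : L 0 = 0 by have := LL (-1) 0 0; rewrite !scaleN1r addNr => ->; rewrite addNr.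
have xE : x = L x.
  rewrite sE /teval (big_nth (0, fun=> 0)) big_mkord.
  have -> (c : 'I_(size s) -> C) z : L (\sum_i c i *: z i) = \sum_i c i *: L (z i).
    by elim/big_rec2: _ => [//|i y1 y2 _ <-]; exact: LL.
  apply: eq_bigr => i _; congr (_ *: _); rewrite /L.
  have vE : (nth (0, fun=> 0) s i).2 = fun t => \sum_(j < n) f t j (v t i) *: e t j.
    by apply/functional_extensionality_dep => t; rewrite -fv // ltnS ltnW.
  rewrite {1}vE (multilinear_sum (@tpure_multilinear R m V)) ?card_ord //.
  by apply: eq_bigr => g _; rewrite tlift_pure.
by rewrite xE /L big1 // => g _; rewrite (x0 _ K) ?scale0r.
Qed.

Lemma lambda_norm_eq0 n (u : 'M[tensor V]_n) : lambda_norm lam D u = 0 -> u = 0.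
Proof.
move=> u0; apply/matrixP => i j; rewrite [RHS]mxE.
apply: tensor_eq0_functionals => f K fL K0 fK.
apply: Normc.eq0_normc; apply/le_anti; rewrite normc_ge0 andbT.
by have := prod_functional_bound u i j fL K0 fK; rewrite u0 mulr0.
Qed.

Lemma lambda_operator_space : operator_space (fun n => @lambda_norm R m tau lam V D n).
Proof.
split=> [n v _|n v _|n c v _|n v w _|n p v w _ _|n k a v b _ _].
- exact: (lambda_norm_ge0 lam_std V_os).
- exact: lambda_norm_eq0.
- exact: (lambda_norm_scale lam_std V_os).
- exact: (lambda_normD lam_std V_os).
- exact: (lambda_norm_block lam_std V_os).
- exact: (lambda_norm_compress lam_std V_os).
Qed.

End LambdaOperatorSpace.

(** * Involution and cones *)

Section StarTheory.
Variables (R : realType) (V : lmodType R[i]) (s : V -> V).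
Hypothesis sA : antilinear s.

Lemma starVB p q (v w : 'M[V]_(p, q)) : starV s (v - w) = starV s v - starV s w.
Proof.
apply/matrixP => i j; rewrite !mxE addrC -scaleN1r sA.
by rewrite rmorphN1 scaleN1r addrC.
Qed.

Lemma starVK p q (v : 'M[V]_(p, q)) : involutive s -> starV s (starV s v) = v.
Proof. by move=> sK; apply/matrixP => i j; rewrite !mxE sK. Qed.

End StarTheory.

Section Seminorm.
Variables (R : realType) (V : lmodType R[i]) (N : forall n, 'M[V]_n -> R).
Hypothesis NV : operator_space N.
Variable n : nat.
Hypothesis n0 : (0 < n)%N.

Lemma os_normN (v : 'M[V]_n) : N (- v) = N v.
Proof.
have -> : - v = scaleV (-1) v by apply/matrixP => i j; rewrite !mxE scaleN1r.
by rewrite (os_scale NV) // normcN Normc.normc1 mul1r.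
Qed.

Lemma os_dist_triangle (v w x : 'M[V]_n) : N (v - x) <= N (v - w) + N (w - x).
Proof.
have -> : v - x = (v - w) + (w - x) by rewrite addrA subrK.
exact: os_triangle.
Qed.

End Seminorm.

Section ConeBlock.
Variables (R : realType) (V : lmodType R[i]) (D : mo_structure V).
Hypothesis DV : mo_operator_space D.

(** Each diagonal corner is a compression of v or w by a coordinate row, and the cone is closed
    under sums. *)
Lemma mo_cone_block n p (v : 'M[V]_n) (w : 'M[V]_p) : (0 < n)%N -> (0 < p)%N ->
  mcone D v -> mcone D w -> mcone D (block_mx v 0 0 w).
Proof.
move=> n0 p0 cv cw; have np0 : (0 < n + p)%N by rewrite addn_gt0 n0.
have -> : block_mx v 0 0 w = block_mx v 0 0 0 + block_mx 0 0 0 w.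
  by rewrite add_block_mx !addr0 add0r.
apply: (mo_coneD DV np0).
  rewrite -col_block_row; have := mo_cone_compress DV (row_mx 1%:M 0) n0 np0 cv.
  by rewrite adj_row_mx trmx1 map_mx1 trmx0 map_mx0.
rewrite -col_block_row_dr; have := mo_cone_compress DV (row_mx 0 1%:M) p0 np0 cw.
by rewrite adj_row_mx trmx1 map_mx1 trmx0 map_mx0.
Qed.

End ConeBlock.

Section LambdaCones.
Variables (R : realType) (m : nat) (tau : nat -> nat).
Local Notation C := R[i].
Local Notation normc := Normc.normc.
Variable lam : forall k, ('I_m -> 'M[C]_k) -> 'M[C]_(tau k).
Hypotheses (lam_std : standing_conditions lam) (lam_O1 : condO1 lam).
Variable V : 'I_m -> lmodType C.
Variable D : forall t, mo_structure (V t).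
Hypothesis V_mo : forall t, mo_operator_space (D t).

Let V_os t := mo_os (V_mo t).
Let star := tstar (fun t => mstar (D t)).
Let starA : antilinear star := tstar_antilinear (fun t => mo_star_antilinear (V_mo t)).

Lemma tstarK : involutive star.
Proof.
have s0 : star 0 = 0.
  by have := starA (-1) 0 0; rewrite scaleN1r addNr rmorphN1 scaleN1r => ->; rewrite addNr.
elim/tensor_ind => [|c v x ih]; first by rewrite !s0.
rewrite !starA ih conjCK /star !tstar_pure //; try by move=> t; apply: mo_star_antilinear.
by congr (_ *: tpure _ + _); apply/functional_extensionality_dep => t; rewrite mo_starK.
Qed.

(** The adjoint swaps the two outer factors of a balanced representation, whose bounds agree; as the
    involution is its own inverse, one inequality suffices. *)
Lemma lambda_norm_star n (u : 'M[tensor V]_n) :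
  lambda_norm lam D (starV star u) = lambda_norm lam D u.
Proof.
suff le (w : 'M[tensor V]_n) : lambda_norm lam D (starV star w) <= lambda_norm lam D w.
  by apply/le_anti; rewrite le -{1}(starVK u tstarK) le.
rewrite -[leRHS]mul1r; apply: le_mul_gt => // c wc.
have c0 := le_trans (lambda_norm_ge0 lam_std V_os w) (ltW wc).
have [j [a [v [b [j0 wE v1 ac bc]]]]] := lambda_norm_lt_rep lam_std V_os wc.
rewrite mul1r; apply: (lambda_rep_le_norm V_os) => //.
exists j, (b^t*), (fun t => starV (mstar (D t)) (v t)), (a^t*); split=> //.
- rewrite wE tens_lam_star // => t; exact: (mo_star_antilinear (V_mo t)).
- by move=> t; rewrite (mo_star_isometry (V_mo t)).
- by rewrite opnorm_adj.
- by rewrite opnorm_adj.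
Qed.

Lemma lambda_precone_sa n (u : 'M[tensor V]_n) :
  lambda_precone lam D u -> starV star u = u.
Proof.
move=> [j [v [a [j0 cv ->]]]]; rewrite tens_lam_star //; last first.
  by move=> t; exact: (mo_star_antilinear (V_mo t)).
rewrite adjmxK; congr (_ *ml tens_lam lam _ *mr _).
by apply/functional_extensionality_dep => t; rewrite (mo_cone_sa (V_mo t)).
Qed.

Lemma lambda_precone0 n : lambda_precone lam D (0 : 'M[tensor V]_n).
Proof.
exists 1%N, (fun=> 0), 0; rewrite lmul0V rmul0V; split=> // t.
exact: (mo_cone0 (V_mo t)).
Qed.

Lemma lambda_preconeD n (u w : 'M[tensor V]_n) :
  lambda_precone lam D u -> lambda_precone lam D w -> lambda_precone lam D (u + w).
Proof.
move=> [r [v1 [a1 [r0 c1 ->]]]] [s [v2 [a2 [s0 c2 ->]]]].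
have [P P1 PE] := tens_lam_direct_sum lam_std v1 v2 r0 s0.
exists (r + s)%N, (fun t => block_mx (v1 t) 0 0 (v2 t)), (row_mx a1 a2 *m P).
split=> [|t|]; first by rewrite addn_gt0 r0.
- exact: (mo_cone_block (V_mo t)).
- by rewrite -row_block_col PE mulV_sandwich adjmxM adj_row_mx.
Qed.

Lemma lambda_preconeZ n r (u : 'M[tensor V]_n) : 0 <= r ->
  lambda_precone lam D u -> lambda_precone lam D (scaleV (r%:C)%C u).
Proof.
move=> r0 [j [v [a [j0 cv ->]]]].
(* The outer factor occurs twice, so it takes the square root of r. *)
exists j, v, ((Num.sqrt r)%:C%C *: a); split=> //.
have -> : ((Num.sqrt r)%:C%C *: a)^t* = (Num.sqrt r)%:C%C *: a^t*.
  apply/matrixP => x y; rewrite !mxE rmorphM; congr (_ * _).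
  exact: conjc_real.
rewrite lscale_mulV scale_rmulV rscale_mulV scaleVA -rmorphM /= -expr2.
by rewrite sqr_sqrtr.
Qed.

Lemma lambda_precone_compress n k (a : 'M[C]_(n, k)) (u : 'M[tensor V]_n) :
  lambda_precone lam D u -> lambda_precone lam D (a^t* *ml u *mr a).
Proof.
move=> [j [v [b [j0 cv ->]]]]; exists j, v, (a^t* *m b); split=> //.
by rewrite mulV_sandwich adjmxM adjmxK.
Qed.

End LambdaCones.

(** * Passage from the cones C_n to their closures *)

Theorem proposition3p4 (R : realType) (m : nat) (tau : nat -> nat)
    (lam : forall k, ('I_m -> 'M[R[i]]_k) -> 'M[R[i]]_(tau k))
    (lam_std : standing_conditions lam)
    (lam_O1 : condO1 lam) (lam_O2 : condO2 lam)
    (V : 'I_m -> lmodType R[i])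
    (D : forall t, mo_structure (V t))
    (V_mo : forall t, mo_operator_space (D t)) :
  mo_operator_space (lambda_tensor lam D).
Proof.
have V_os t := mo_os (V_mo t).
have N_os := lambda_operator_space lam_std V_os.
have starA := tstar_antilinear (fun t => mo_star_antilinear (V_mo t)).
have isom n := @lambda_norm_star _ _ _ _ lam_std lam_O1 _ _ V_mo n.
(* The operator space axioms, antilinearity and the isometry are closed here; involutivity and the
   cone axioms remain. *)
split=> [|||n v n0 cv|n n0|n v w n0 cv cw|n r v n0 r0 cv|n k a v n0 k0 cv|n v n0|n n0 v cv] //=.
- exact: tstarK V_mo.
(* For w in C_n near v, w^* = w and the isometry give |v^* - v| <= |v^* - w^*| + |w - v| = 2 |v -
   w|; definiteness then concludes. *)
- apply/eqP; rewrite -subr_eq0; apply/eqP; apply: (os_eq0 N_os n0).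
  apply/le_anti; rewrite (os_ge0 N_os) // andbT; apply/ler_addgt0Pr => e e0.
  have [w cw vw] := cv (e / 2) (divr_gt0 e0 (ltr0n _ 2)).
  have := os_dist_triangle N_os n0 (starV (tstar (fun t => mstar (D t))) v) w v.
  rewrite -{1}(lambda_precone_sa lam_O1 V_mo cw) -starVB // isom.
  rewrite -(os_normN N_os n0 (w - v)) opprB; lra.
- move=> e e0; exists 0; last by rewrite subr0 (os_norm0 N_os).
  exact: lambda_precone0.
- move=> e e0; have e2 : 0 < e / 2 := divr_gt0 e0 (ltr0n _ 2).
  have [v' cv' vv'] := cv _ e2; have [w' cw' ww'] := cw _ e2.
  exists (v' + w'); first exact: lambda_preconeD.
  by rewrite opprD addrACA; have := os_triangle N_os (v - v') (w - w') n0; lra.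
(* The tolerance is divided by r + 1 since r may be 0; likewise K + 1 for compressions. *)
- move=> e e0; have r1 : 0 < r + 1 by lra.
  have [v' cv' vv'] := cv (e / (r + 1)) (divr_gt0 e0 r1).
  exists (scaleV (r%:C)%C v'); first exact: lambda_preconeZ.
  have -> : scaleV (r%:C)%C v - scaleV (r%:C)%C v' = scaleV (r%:C)%C (v - v').
    by apply/matrixP => i j; rewrite !mxE scalerBr.
  rewrite (os_scale N_os) // normc_real ger0_norm //.
  have N0 := os_ge0 N_os (v - v') n0.
  move: vv'; rewrite ltr_pdivlMr // mulrC; apply: le_lt_trans.
  by rewrite ler_wpM2r // lerDl.
- move=> e e0; pose K := opnorm a * opnorm a.
  have K0 : 0 <= K by rewrite mulr_ge0 ?opnorm_ge0.
  have K1 : 0 < K + 1 by lra.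
  have [v' cv' vv'] := cv (e / (K + 1)) (divr_gt0 e0 K1).
  exists (a^t* *ml v' *mr a); first exact: lambda_precone_compress.
  rewrite -rmulVB -lmulVB.
  apply: le_lt_trans (os_compress N_os _ _ _ n0 k0) _.
  have N0 := os_ge0 N_os (v - v') n0.
  rewrite opnorm_adj mulrAC; move: vv'; rewrite ltr_pdivlMr // mulrC.
  by apply: le_lt_trans; rewrite ler_wpM2r // lerDl.
(* A closure is closed: approximate twice within e / 2. *)
- move=> e e0; have e2 : 0 < e / 2 := divr_gt0 e0 (ltr0n _ 2).
  have [w cw vw] := cv _ e2; have [x cx wx] := cw _ e2.
  exists x => //; have := os_dist_triangle N_os n0 v w x; move: vw wx => /=; lra.
Qed.
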